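(* Let $\bar\sigma\in\Sigma$. There exists a constant $c_{\mathrm{E}}>0$ independent of $N$ such that for all $t\in[0,T]$ $$\|\widehat{x}_{\mathrm{E}}(t)-\widehat{x}_{\bar\sigma}(t)\|_{P_{\bar\sigma}(t)}\le c_{\mathrm{E}}\;\mathbb{E}\big[\|\mathcal{S}_\sigma-\mathcal{S}_{\bar\sigma}\|_1\big].$$
   Context: Let $T>0$, $n,m,r\in\mathbb{N}$, $B\in\mathbb{R}^{n,m}$, $C\in\mathbb{R}^{r,n}$, $x_0\in\mathbb{R}^n$ and $y\in L^2(0,T;\mathbb{R}^r)$. $\|\cdot\|$ is the Euclidean norm on vectors and the induced norm on matrices; for a symmetric positive definite matrix $M$ set $\|z\|_M^2=z^\top M z$. Uncertain parameters: $\Sigma_A,\Sigma_\Gamma,\Sigma_R,\Sigma_Q$ are nonempty finite subsets of Euclidean spaces, $\Sigma=\Sigma_A\times\Sigma_\Gamma\times\Sigma_R\times\Sigma_Q=\{\sigma_1,\dots,\sigma_N\}$ has $N$ elements and carries the uniform probability measure, so $\mathbb{E}[f(\sigma)]=\frac1N\sum_{k=1}^N f(\sigma_k)$. Each $\sigma=(\sigma_A,\sigma_\Gamma,\sigma_R,\sigma_Q)\in\Sigma$ determines a matrix $A_\sigma\in\mathbb{R}^{n,n}$ (depending only on $\sigma_A$) and symmetric positive definite matrices $\Gamma_\sigma\in\mathbb{R}^{n,n}$ (depending only on $\sigma_\Gamma$), $R_\sigma\in\mathbb{R}^{m,m}$ (depending only on $\sigma_R$), $Q_\sigma\in\mathbb{R}^{r,r}$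 (depending only on $\sigma_Q$). For a quadruple of matrices write $\mathcal{S}_\sigma=(A_\sigma,\Gamma_\sigma,R_\sigma,Q_\sigma)$; differences are componentwise and $\|(A,\Gamma,R,Q)\|_1=\|A\|+\|\Gamma\|+\|R\|+\|Q\|$. For every $\sigma\in\Sigma$, $\Pi_\sigma$ and $\widehat{x}_\sigma$ are the unique solutions on $[0,T]$ of $$\dot\Pi_\sigma=A_\sigma\Pi_\sigma+\Pi_\sigma A_\sigma^\top-\Pi_\sigma C^\top Q_\sigma^{-1}C\Pi_\sigma+BR_\sigma B^\top,\quad\Pi_\sigma(0)=\Gamma_\sigma,$$ $$\dot{\widehat{x}}_\sigma=A_\sigma\widehat{x}_\sigma+\Pi_\sigma C^\top Q_\sigma^{-1}(y-C\widehat{x}_\sigma),\quad\widehat{x}_\sigma(0)=x_0,$$ and $P_\sigma(t)=\Pi_\sigma^{-1}(t)$ (symmetric positive definite). Write $\widehat{x}_k=\widehat{x}_{\sigma_k}$, $P_k=P_{\sigma_k}$, $Q_k=Q_{\sigma_k}$. The expected energy is $$E(t,\xi)=\frac{1}{2N}\sum_{k=1}^N\Big((\xi-\widehat{x}_k(t))^\top P_k(t)(\xi-\widehat{x}_k(t))+\int_0^t\|y(s)-C\widehat{x}_k(s)\|_{Q_k^{-1}}^2\,\mathrm{d}s\Big),$$ and $\widehat{x}_{\mathrm{E}}(t)$ is its unique minimizer over $\xi\in\mathbb{R}^n$, i.e. $\widehat{x}_{\mathrm{E}}(t)=\big(\sum_{k=1}^NP_k(t)\big)^{-1}\sum_{k=1}^NP_k(t)\widehat{x}_k(t)$.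 ''Independent of $N$'' means that the constant does not depend on the number $N$ of parameters; it may depend on $T,B,C,x_0,y$ and on the matrices involved. *)

(* Defs.v *)
(* Written with MathComp and MathComp-Analysis. *)
From HB Require Import structures.
From mathcomp Require Import all_boot all_order all_algebra.
From mathcomp Require Import finmap.
From mathcomp Require Import all_classical all_reals all_analysis.
Import Order.TTheory GRing.Theory Num.Theory.
Import numFieldNormedType.Exports.

Set Implicit Arguments.
Unset Strict Implicit.
Unset Printing Implicit Defensive.

Local Open Scope classical_set_scope.
Local Open Scope ring_scope.

(* The library norm `|A| on matrices is the max norm, hence the explicit
   Euclidean and induced norms below. *)
Definition enorm (R : realType) (k : nat) (v : 'cV[R]_k) : R :=
  Num.sqrt (\sum_(i < k) v i 0 ^+ 2).

Definition opnorm (R : realType) (k l : nat) (A : 'M[R]_(k, l)) : R :=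
  sup [set enorm (A *m v) | v in [set v : 'cV[R]_l | enorm v <= 1]].

Definition wsq (R : realType) (k : nat) (M : 'M[R]_k) (z : 'cV[R]_k) : R :=
  (z^T *m M *m z) 0 0.

Definition wnorm (R : realType) (k : nat) (M : 'M[R]_k) (z : 'cV[R]_k) : R :=
  Num.sqrt (wsq M z).

Definition spd (R : realType) (k : nat) (M : 'M[R]_k) : Prop :=
  M^T = M /\ forall z : 'cV[R]_k, z != 0 -> 0 < wsq M z.

(* Quadruples (A, Gamma, R, Q); subtraction on this product type is
   componentwise. *)
Definition quadruple (R : realType) (n m r : nat) : zmodType :=
  ('M[R]_n * 'M[R]_n * 'M[R]_m * 'M[R]_r)%type.

Definition norm1 (R : realType) (n m r : nat) (S : quadruple R n m r) : R :=
  let: (A, G, W, Q) := S in opnorm A + opnorm G + opnorm W + opnorm Q.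

Definition admissible (R : realType) (n m r : nat) (S : quadruple R n m r)
    : Prop :=
  let: (A, G, W, Q) := S in [/\ spd G, spd W & spd Q].

(* Any finite family of admissible quadruples satisfies this for M large
   enough. A constant that depends on the quadruples through M only cannot
   depend on their number. *)
Definition bounded_by (R : realType) (n m r : nat) (M : R)
    (S : quadruple R n m r) : Prop :=
  let: (A, G, W, Q) := S in
  [/\ opnorm A <= M,
      opnorm G <= M /\ opnorm (invmx G) <= M,
      opnorm W <= M /\ opnorm (invmx W) <= M
    & opnorm Q <= M /\ opnorm (invmx Q) <= M].

Definition param (R : realType) (pA pG pR pQ : nat) : choiceType :=
  ('rV[R]_pA * 'rV[R]_pG * 'rV[R]_pR * 'rV[R]_pQ)%type.

Definition param_set (R : realType) (pA pG pR pQ : nat)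
    (SA : {fset 'rV[R]_pA}) (SG : {fset 'rV[R]_pG})
    (SR : {fset 'rV[R]_pR}) (SQ : {fset 'rV[R]_pQ})
    : {fset param R pA pG pR pQ} :=
  (SA `*` SG `*` SR `*` SQ)%fset.

Definition quadruple_of (R : realType) (n m r pA pG pR pQ : nat)
    (A : 'rV[R]_pA -> 'M[R]_n) (G : 'rV[R]_pG -> 'M[R]_n)
    (W : 'rV[R]_pR -> 'M[R]_m) (Q : 'rV[R]_pQ -> 'M[R]_r)
    (s : param R pA pG pR pQ) : quadruple R n m r :=
  let: (sA, sG, sR, sQ) := s in (A sA, G sG, W sR, Q sQ).

Definition expectation_over (R : realType) (K : choiceType) (Sigma : {fset K})
    (f : K -> R) : R :=
  (#|` Sigma|%:R)^-1 * \sum_(s <- Sigma) f s.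

(* y belongs to L^2(0,T; R^r), through a Borel representative. *)
Definition square_integrable (R : realType) (T : R) (r : nat)
    (y : R -> 'cV[R]_r) : Prop :=
  forall i : 'I_r,
    measurable_fun `]0, T[ (fun t => y t i 0) /\
    (@lebesgue_measure R).-integrable `]0, T[
      (fun t => ((y t i 0) ^+ 2)%:E).

(* Classical solution of the Riccati equation on [0,T]. *)
Definition riccati_solution (R : realType) (T : R) (n m r : nat)
    (B : 'M[R]_(n, m)) (C : 'M[R]_(r, n)) (S : quadruple R n m r)
    (Pi : R -> 'M[R]_n) : Prop :=
  let: (A, G, W, Q) := S in
  [/\ Pi 0 = G,
      forall i j : 'I_n, {within `[0, T], continuous (fun t => Pi t i j)}
    & forall t : R, 0 < t < T -> forall i j : 'I_n,
        is_derive t (1 : R) (fun u => Pi u i j)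
          ((A *m Pi t + Pi t *m A^T
            - Pi t *m C^T *m invmx Q *m C *m Pi t
            + B *m W *m B^T) i j)].

Definition filter_rhs (R : realType) (n m r : nat)
    (C : 'M[R]_(r, n)) (y : R -> 'cV[R]_r) (S : quadruple R n m r)
    (Pi : R -> 'M[R]_n) (t : R) (x : 'cV[R]_n) : 'cV[R]_n :=
  let: (A, G, W, Q) := S in
  A *m x + Pi t *m C^T *m invmx Q *m (y t - C *m x).

(* Since y is merely square integrable, solutions of the filter equation are
   understood in the sense of Caratheodory: absolutely continuous functions
   satisfying the equation almost everywhere, i.e. indefinite Lebesgue
   integrals of the right-hand side. *)
Definition filter_solution (R : realType) (T : R) (n m r : nat)
    (C : 'M[R]_(r, n)) (x0 : 'cV[R]_n) (y : R -> 'cV[R]_r)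
    (S : quadruple R n m r) (Pi : R -> 'M[R]_n) (x : R -> 'cV[R]_n) : Prop :=
  forall i : 'I_n,
    (@lebesgue_measure R).-integrable `[0, T]
      (fun s => (filter_rhs C y S Pi s (x s) i 0)%:E) /\
    forall t : R, 0 <= t <= T ->
      x t i 0 = x0 i 0 +
        (\int[lebesgue_measure]_(s in `[0, t])
           filter_rhs C y S Pi s (x s) i 0)%R.

Definition expected_energy (R : realType) (n r : nat) (K : choiceType)
    (Sigma : {fset K}) (C : 'M[R]_(r, n)) (y : R -> 'cV[R]_r)
    (Q : K -> 'M[R]_r) (P : K -> R -> 'M[R]_n) (xhat : K -> R -> 'cV[R]_n)
    (t : R) (xi : 'cV[R]_n) : R :=
  (2 * #|` Sigma|%:R)^-1 *
  \sum_(s <- Sigma)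
    (wsq (P s t) (xi - xhat s t) +
     (\int[lebesgue_measure]_(u in `[0, t])
        (wnorm (invmx (Q s)) (y u - C *m xhat s u) ^+ 2))%R).

Definition minimizer (R : realType) (n : nat) (f : 'cV[R]_n -> R)
    (x : 'cV[R]_n) : Prop :=
  forall xi, f x <= f xi.

(* Main.v *)
Require Import Defs.
From HB Require Import structures.
From mathcomp Require Import all_boot all_order all_algebra.
From mathcomp Require Import finmap.
From mathcomp Require Import zify ring lra.
From mathcomp Require Import all_classical all_reals all_analysis.
From mathcomp Require Import measurable_realfun.
Import Order.TTheory GRing.Theory Num.Theory.
Import numFieldNormedType.Exports.

Set Implicit Arguments.
Unset Strict Implicit.
Unset Printing Implicit Defensive.

Local Open Scope classical_set_scope.
Local Open Scope ring_scope.

(** The minimizer of the energy is an average of the estimates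
    $\widehat x_\sigma$ with matrix weights $P_\sigma$, so its distance to
    $\widehat x_{\bar\sigma}$ is at most a constant times the mean of the
    distances of $\widehat x_\sigma$ to $\widehat x_{\bar\sigma}$, the constant
    being a condition number common to all weights ([minimizer_near]).  It
    remains to see that $\Pi_\sigma$ is bounded above and below uniformly in
    the data, and that $\widehat x_\sigma$ depends on the data in a Lipschitz
    way.  No constant may depend on the number of parameters; all of them are
    produced before the data are introduced, from one bound on the matrices.

    Lower bound on $\Pi$ ([riccati_lower]).  Compare $\Pi(t)$ with
    $\psi(t) I$, where $\psi(t) = \varepsilon e^{-\kappa t}$.  As long as
    $\Pi - \psi I$ is positive semidefinite it can only degenerate along a
    vector $z$ with $\Pi z = \psi z$; along such a vector the quadratic term of
    the Riccati equation is only $O(\psi^2)$, hence $z^\top(\Pi - \psi I)z$ has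
    a positive derivative once $\kappa$ is large, and it would have been
    negative just before.  So $\Pi - \psi I$ never degenerates.  This argument
    yields positivity and the quantitative bound together, without
    differentiating $\Pi^{-1}$.

    Upper bound ([riccati_upper]).  For a positive semidefinite $\Pi$ the
    trace controls every entry, and dropping the nonpositive quadratic term
    leaves a linear differential inequality for the trace.

    Lipschitz dependence ([riccati_lipschitz], [filter_lipschitz]).  The
    difference of two solutions satisfies a linear inequality whose
    inhomogeneity is the distance between the data, and Gronwall's inequality
    applies: in differential form to the Riccati equation, in integral form to
    the filter equation, which holds only almost everywhere because $y$ is
    merely square integrable.

    Intermediate estimates use the sum of the absolute values of the entries
    as a norm.  It is submultiplicative for matrices of all shapes and
    dominated by the induced norm up to a factor depending on the dimensions
    only. *)

(** * The entry-sum norm *)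

Definition mxl1 (R : realType) (k l : nat) (A : 'M[R]_(k, l)) : R :=
  \sum_i \sum_j `|A i j|.

Section EntrySumNorm.
Context {R : realType}.

Lemma mxl1_ge0 k l (A : 'M[R]_(k, l)) : 0 <= mxl1 A.
Proof. by apply: sumr_ge0 => i _; apply: sumr_ge0. Qed.

Lemma mxl1_entry k l (A : 'M[R]_(k, l)) i j : `|A i j| <= mxl1 A.
Proof.
rewrite /mxl1 (bigD1 i)//= (bigD1 j)//= -addrA lerDl.
by apply: addr_ge0; apply: sumr_ge0 => // ? _; apply: sumr_ge0.
Qed.

Lemma mxl10 k l : mxl1 (0 : 'M[R]_(k, l)) = 0.
Proof. by rewrite /mxl1 big1// => i _; rewrite big1// => j _; rewrite mxE normr0. Qed.

Lemma mxl1N k l (A : 'M[R]_(k, l)) : mxl1 (- A) = mxl1 A.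
Proof. by apply: eq_bigr => i _; apply: eq_bigr => j _; rewrite mxE normrN. Qed.

Lemma mxl1D k l (A B : 'M[R]_(k, l)) : mxl1 (A + B) <= mxl1 A + mxl1 B.
Proof.
rewrite -big_split/=; apply: ler_sum => i _.
by rewrite -big_split/=; apply: ler_sum => j _; rewrite mxE ler_normD.
Qed.

Lemma mxl1T k l (A : 'M[R]_(k, l)) : mxl1 A^T = mxl1 A.
Proof.
rewrite /mxl1 exchange_big/=; apply: eq_bigr => i _.
by apply: eq_bigr => j _; rewrite mxE.
Qed.

Lemma mxl1M k l p (A : 'M[R]_(k, l)) (B : 'M[R]_(l, p)) :
  mxl1 (A *m B) <= mxl1 A * mxl1 B.
Proof.
rewrite {2}/mxl1 mulr_suml; apply: ler_sum => i _.
apply: (@le_trans _ _ (\sum_j \sum_h `|A i h| * `|B h j|)).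
  apply: ler_sum => j _; rewrite mxE; apply: le_trans (ler_norm_sum _ _ _) _.
  by apply: ler_sum => h _; rewrite normrM.
rewrite exchange_big/= mulr_suml; apply: ler_sum => h _.
rewrite -mulr_sumr ler_wpM2l// /mxl1 (bigD1 h)//= lerDl.
by apply: sumr_ge0 => ? _; apply: sumr_ge0.
Qed.

Lemma mxl1M_le k l p (A : 'M[R]_(k, l)) (B : 'M[R]_(l, p)) a b :
  mxl1 A <= a -> mxl1 B <= b -> mxl1 (A *m B) <= a * b.
Proof. by move=> Aa Bb; apply: le_trans (mxl1M _ _) _; rewrite ler_pM ?mxl1_ge0. Qed.

Lemma mxl1D_le k l (A B : 'M[R]_(k, l)) a b :
  mxl1 A <= a -> mxl1 B <= b -> mxl1 (A + B) <= a + b.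
Proof. by move=> Aa Bb; apply: le_trans (mxl1D _ _) _; rewrite lerD. Qed.

Lemma mxl1B_le k l (A B : 'M[R]_(k, l)) a b :
  mxl1 A <= a -> mxl1 B <= b -> mxl1 (A - B) <= a + b.
Proof. by rewrite -(mxl1N B); apply: mxl1D_le. Qed.

Lemma mxl1_eq0 k l (A : 'M[R]_(k, l)) : mxl1 A <= 0 -> A = 0.
Proof.
move=> A0; apply/matrixP => i j; rewrite mxE; apply/eqP; rewrite -normr_le0.
exact: le_trans (mxl1_entry _ _ _) A0.
Qed.

(** Cauchy-Schwarz against the constant vector: the products [a i * a j] are
    bounded by the arithmetic mean of the squares. *)
Lemma sqr_sum_le (I : finType) (a : I -> R) :
  (\sum_i a i) ^+ 2 <= #|I|%:R * \sum_i a i ^+ 2.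
Proof.
rewrite expr2 mulr_suml.
apply: (@le_trans _ _ (\sum_i \sum_j (a i ^+ 2 + a j ^+ 2) / 2)).
  apply: ler_sum => i _; rewrite mulr_sumr; apply: ler_sum => j _.
  by have := sqr_ge0 (a i - a j); nra.
set S := \sum_i a i ^+ 2.
have -> : \sum_i \sum_j (a i ^+ 2 + a j ^+ 2) / 2 =
   \sum_i (#|I|%:R * (a i ^+ 2 / 2) + S / 2).
  apply: eq_bigr => i _; under eq_bigr do rewrite mulrDl.
  by rewrite big_split/= sumr_const mulr_natl; congr (_ + _); rewrite -mulr_suml.
rewrite big_split/= sumr_const -mulr_sumr -mulr_suml -/S.
by rewrite -[(S / 2) *+ _]mulr_natl -mulrDr -splitr.
Qed.

Lemma mxl1_sqr_le_sum k l (A : 'M[R]_(k, l)) :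
  mxl1 A ^+ 2 <= (k * l)%:R * \sum_i \sum_j A i j ^+ 2.
Proof.
rewrite /mxl1 !pair_bigA/=; apply: le_trans (sqr_sum_le _) _.
rewrite card_prod !card_ord ler_wpM2l//; apply: ler_sum => p _.
by rewrite real_normK// num_real.
Qed.

Lemma sum_sqr_le_mxl1 k l (A : 'M[R]_(k, l)) :
  \sum_i \sum_j A i j ^+ 2 <= mxl1 A ^+ 2.
Proof.
rewrite expr2 {1}/mxl1 mulr_suml; apply: ler_sum => i _.
rewrite mulr_suml; apply: ler_sum => j _.
by rewrite -(real_normK (num_real (A i j))) expr2 ler_wpM2l// mxl1_entry.
Qed.

End EntrySumNorm.

(** * Quadratic forms *)

Definition dot (R : realType) (k : nat) (u v : 'cV[R]_k) : R := (u^T *m v) 0 0.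

Definition psd (R : realType) (k : nat) (M : 'M[R]_k) : Prop :=
  M^T = M /\ forall z : 'cV[R]_k, 0 <= dot z (M *m z).

Section QuadraticForms.
Context {R : realType} {k : nat}.
Implicit Types (u v w z : 'cV[R]_k) (M : 'M[R]_k).

Lemma dotE u v : dot u v = \sum_i u i 0 * v i 0.
Proof. by rewrite /dot mxE; apply: eq_bigr => i _; rewrite mxE. Qed.

Lemma dotC u v : dot u v = dot v u.
Proof. by rewrite !dotE; apply: eq_bigr => i _; rewrite mulrC. Qed.

Lemma dotDr u v w : dot u (v + w) = dot u v + dot u w.
Proof. by rewrite /dot mulmxDr mxE. Qed.

Lemma dotNr u v : dot u (- v) = - dot u v.
Proof. by rewrite /dot mulmxN mxE. Qed.

Lemma dotBr u v w : dot u (v - w) = dot u v - dot u w.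
Proof. by rewrite dotDr dotNr. Qed.

Lemma dotZr a u v : dot u (a *: v) = a * dot u v.
Proof. by rewrite /dot -scalemxAr mxE. Qed.

Lemma dotDl u v w : dot (u + v) w = dot u w + dot v w.
Proof. by rewrite !(dotC _ w) dotDr. Qed.

Lemma dotZl a u v : dot (a *: u) v = a * dot u v.
Proof. by rewrite !(dotC _ v) dotZr. Qed.

Lemma dot_ge0 z : 0 <= dot z z.
Proof. by rewrite dotE sumr_ge0// => i _; rewrite -expr2 sqr_ge0. Qed.

Lemma dot_gt0 z : z != 0 -> 0 < dot z z.
Proof.
move=> z0; rewrite lt_neqAle dot_ge0 andbT; apply: contraNN z0 => /eqP/esym.
rewrite dotE => /eqP; rewrite psumr_eq0; last by move=> i _; rewrite -expr2 sqr_ge0.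
move=> /allP H; apply/eqP/matrixP => i j; rewrite ord1 mxE.
by have /= := H i (mem_index_enum _); rewrite mulf_eq0 orbb => /eqP.
Qed.

Lemma dot_le u v : `|dot u v| <= mxl1 u * mxl1 v.
Proof.
by apply: le_trans (mxl1_entry (u^T *m v) 0 0) _; rewrite -(mxl1T u) mxl1M.
Qed.

Lemma mxl1_sqr_le z : mxl1 z ^+ 2 <= k%:R * dot z z.
Proof.
have := mxl1_sqr_le_sum z; rewrite muln1 dotE.
by under [X in _ * X]eq_bigr do rewrite big_ord1 expr2.
Qed.

Lemma wsq_dot M z : wsq M z = dot z (M *m z).
Proof. by rewrite /wsq /dot mulmxA. Qed.

Lemma dot_mulmx l (M : 'M[R]_(k, l)) u (v : 'cV[R]_l) :
  dot u (M *m v) = dot (M^T *m u) v.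
Proof. by rewrite /dot trmx_mul trmxK mulmxA. Qed.

Lemma dot_mulmx_le M u v : `|dot u (M *m v)| <= mxl1 M * (mxl1 u * mxl1 v).
Proof.
apply: le_trans (dot_le _ _) _; rewrite mulrCA ler_wpM2l ?mxl1_ge0//.
exact: mxl1M.
Qed.

Lemma form_le M z : `|dot z (M *m z)| <= k%:R * mxl1 M * dot z z.
Proof.
apply: le_trans (dot_mulmx_le _ _ _) _.
by rewrite [k%:R * _]mulrC -mulrA ler_wpM2l ?mxl1_ge0// -expr2 mxl1_sqr_le.
Qed.

Lemma discriminant_le (a b c : R) : 0 <= c ->
  (forall t, 0 <= a + 2 * t * b + t ^+ 2 * c) -> b ^+ 2 <= a * c.
Proof.
rewrite le_eqVlt => /predU1P[<- H|c0 H].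
  have [->|b0] := eqVneq b 0; first by rewrite mulr0 expr0n.
  have := H (- (a + 1) / (2 * b)); rewrite mulr0 addr0.
  have -> : a + 2 * (- (a + 1) / (2 * b)) * b = -1 by field.
  by rewrite ler0N1.
have := H (- b / c).
have -> : a + 2 * (- b / c) * b + (- b / c) ^+ 2 * c = (a * c - b ^+ 2) / c.
  by field; rewrite gt_eqF.
by rewrite pmulr_lge0 ?invr_gt0// subr_ge0.
Qed.

Lemma psd_cauchy_schwarz M u v : psd M ->
  dot u (M *m v) ^+ 2 <= dot u (M *m u) * dot v (M *m v).
Proof.
move=> [Msym Mge0]; apply: discriminant_le => // t.
have := Mge0 (u + t *: v).
rewrite mulmxDr !dotDr !dotDl -!scalemxAr !dotZr !dotZl.
have -> : dot v (M *m u) = dot u (M *m v) by rewrite dotC dot_mulmx Msym dotC -dotC.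
by congr (0 <= _); ring.
Qed.

(** Cauchy-Schwarz for the form of [M], applied to [z] and [invmx M *m z], whose
    image under [M] is [z]: a bound on the inverse is a lower bound on the
    form.  Applied to [M] equal to [Gamma], to [Pi - psi I] and to the inverse
    of [Pi]. *)
Lemma psd_unit_lower M z : psd M -> M \in unitmx ->
  dot z z <= k%:R * mxl1 (invmx M) * dot z (M *m z).
Proof.
move=> Mpsd Mu; have [->|z0] := eqVneq z 0.
  by rewrite mulmx0 /dot mulmx0 mxE mulr0.
have zz := dot_gt0 z0.
have := psd_cauchy_schwarz z (invmx M *m z) Mpsd.
rewrite mulmxA mulmxV// mul1mx => H.
rewrite -(ler_pM2r zz) -expr2; apply: le_trans H _.
set p := dot z (M *m z); set c := mxl1 _.
have -> : k%:R * c * p * dot z z = p * (k%:R * c * dot z z) by ring.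
rewrite ler_wpM2l//; first by have [_] := Mpsd; exact.
by rewrite dotC; apply: le_trans (ler_norm _) _; rewrite form_le.
Qed.

Lemma nonunit_null_vector M : M^T = M -> M \notin unitmx ->
  exists2 z : 'cV[R]_k, z != 0 & M *m z = 0.
Proof.
move=> Msym; rewrite unitmxE unitfE negbK => /det0P[v v0 vM].
exists v^T; first by rewrite -(inj_eq trmx_inj) trmxK trmx0.
by apply: trmx_inj; rewrite trmx_mul trmxK Msym vM trmx0.
Qed.

Lemma form_gt0_unit M : M^T = M ->
  (forall z : 'cV[R]_k, z != 0 -> 0 < dot z (M *m z)) -> M \in unitmx.
Proof.
move=> Msym Mpos; apply: contraT => /(nonunit_null_vector Msym)[z z0 Mz].
by have := Mpos z z0; rewrite Mz /dot mulmx0 mxE ltxx.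
Qed.

Lemma form_lower_psd M (a : R) : M^T = M -> 0 <= a ->
  (forall z : 'cV[R]_k, a * dot z z <= dot z (M *m z)) -> psd M.
Proof.
by move=> Msym a0 H; split=> // z; apply: le_trans (H z); rewrite mulr_ge0 ?dot_ge0.
Qed.

Lemma form_lower_unit M (a : R) : M^T = M -> 0 < a ->
  (forall z : 'cV[R]_k, a * dot z z <= dot z (M *m z)) -> M \in unitmx.
Proof.
move=> Msym a0 H; apply: form_gt0_unit => // z z0.
by apply: lt_le_trans (H z); rewrite mulr_gt0 ?dot_gt0.
Qed.

Lemma spd_unit M : spd M -> M \in unitmx.
Proof. by move=> [Ms Mp]; apply: form_gt0_unit => // z /Mp; rewrite wsq_dot. Qed.

Lemma spd_psd M : spd M -> psd M.
Proof.
move=> [Ms Mp]; split=> // z; have [->|/Mp/ltW] := eqVneq z 0; last by rewrite wsq_dot.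
by rewrite mulmx0 /dot mulmx0 mxE.
Qed.

Lemma psd_invmx M : psd M -> M \in unitmx -> psd (invmx M).
Proof.
move=> [Ms Mp] Mu; split; first by rewrite trmx_inv Ms.
move=> z; have := Mp (invmx M *m z).
by rewrite mulmxA mulmxV// mul1mx dotC.
Qed.

Lemma trmx_scalar_sub (X : 'M[R]_k) (a : R) : X^T = X -> (X - a%:M)^T = X - a%:M.
Proof. by move=> Xs; rewrite linearB/= Xs tr_scalar_mx. Qed.

Lemma form_scalar_sub (X : 'M[R]_k) (a : R) (z : 'cV[R]_k) :
  dot z ((X - a%:M) *m z) = dot z (X *m z) - a * dot z z.
Proof. by rewrite mulmxBl mul_scalar_mx dotBr dotZr. Qed.

Lemma mx_entry_dot (X : 'M[R]_k) i j :
  X i j = dot (delta_mx i 0) (X *m delta_mx j 0).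
Proof.
rewrite -colE dotE (bigD1 i)//= !mxE !eqxx mul1r big1 ?addr0// => h hi.
by rewrite !mxE (negbTE hi) mul0r.
Qed.

(** By Cauchy-Schwarz each entry is at most the geometric mean of two diagonal
    entries, and these are nonnegative with sum the trace. *)
Lemma mxl1_psd_le (X : 'M[R]_k) : psd X -> mxl1 X <= (k * k)%:R * \tr X.
Proof.
move=> Xp; have XE := mx_entry_dot X.
have Xd i : 0 <= X i i by rewrite XE; case: Xp.
have Xt i : X i i <= \tr X by rewrite /mxtrace (bigD1 i)//= lerDl sumr_ge0.
have tr0 : 0 <= \tr X by rewrite sumr_ge0.
have Xij i j : `|X i j| <= \tr X.
  rewrite -(ler_pXn2r (n := 2)) ?nnegrE// real_normK ?num_real//.
  have := psd_cauchy_schwarz (delta_mx i 0) (delta_mx j 0) Xp; rewrite -!XE.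
  by move/le_trans; apply; rewrite expr2 ler_pM.
apply: (@le_trans _ _ (\sum_(i < k) \sum_(j < k) \tr X)).
  by apply: ler_sum => i _; apply: ler_sum.
by rewrite !sumr_const !card_ord -mulrnA mulr_natl.
Qed.

Lemma psd_tr_ge0 (X : 'M[R]_k) : psd X -> 0 <= \tr X.
Proof.
by move=> [_ Xp]; apply: sumr_ge0 => i _; rewrite mx_entry_dot.
Qed.

Lemma tr_le_mxl1 (X : 'M[R]_k) : \tr X <= mxl1 X.
Proof.
apply: ler_sum => i _; apply: le_trans (ler_norm _) _.
by rewrite (bigD1 i)//= lerDl sumr_ge0.
Qed.

End QuadraticForms.

Lemma psd_congr (R : realType) k l (M : 'M[R]_k) (X : 'M[R]_(k, l)) :
  psd M -> psd (X^T *m M *m X).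
Proof.
move=> [Ms Mp]; split; first by rewrite !trmx_mul trmxK Ms mulmxA.
by move=> z; rewrite -!mulmxA dot_mulmx trmxK.
Qed.

(** With [v = invmx X *m w], coercivity gives [a |v|^2 <= <v, w>], and one
    factor [|v|] cancels. *)
Lemma inverse_mulmx_le (R : realType) n (X : 'M[R]_n) (a : R) (w : 'cV[R]_n) :
  0 < a -> X \in unitmx -> (forall z, a * dot z z <= dot z (X *m z)) ->
  mxl1 (invmx X *m w) <= n%:R / a * mxl1 w.
Proof.
move=> a0 Xu low; set v := invmx X *m w.
have [v0|v0] := leP (mxl1 v) 0.
  by apply: le_trans v0 _; rewrite mulr_ge0 ?mxl1_ge0// divr_ge0// ltW.
rewrite -(ler_pM2r v0) -expr2; apply: le_trans (mxl1_sqr_le v) _.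
rewrite -!mulrA ler_wpM2l// mulrC ler_pdivlMr// mulrC.
apply: le_trans (low v) _; rewrite /v mulmxA mulmxV// mul1mx.
by apply: le_trans (ler_norm _) _; rewrite mulrC dot_le.
Qed.

(** * Comparison with the induced norm *)

Section OperatorNorm.
Context {R : realType}.

Lemma enorm_delta_mx k (j : 'I_k) : enorm (delta_mx j 0 : 'cV[R]_k) = 1.
Proof.
rewrite /enorm (bigD1 j)//= mxE !eqxx expr1n big1 ?addr0 ?sqrtr1// => i ij.
by rewrite mxE (negbTE ij) expr0n.
Qed.

Lemma enorm_entry k (v : 'cV[R]_k) i : `|v i 0| <= enorm v.
Proof.
rewrite -sqrtr_sqr ler_sqrt ?sumr_ge0//; last by move=> *; rewrite sqr_ge0.
by rewrite (bigD1 i)//= lerDl sumr_ge0// => *; rewrite sqr_ge0.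
Qed.

Lemma enorm_le_mxl1 k (v : 'cV[R]_k) : enorm v <= mxl1 v.
Proof.
rewrite -[mxl1 v]ger0_norm ?mxl1_ge0// -sqrtr_sqr ler_wsqrtr//.
have -> : mxl1 v = \sum_i `|v i 0|.
  by apply: eq_bigr => i _; rewrite big_ord1.
rewrite expr2 mulr_suml; apply: ler_sum => i _.
rewrite -(real_normK (num_real (v i 0))) expr2 ler_wpM2l//.
by rewrite (bigD1 i)//= lerDl sumr_ge0.
Qed.

(** The supremum of an unbounded set would be a junk value, so boundedness has
    to be known before [opnorm] can bound anything. *)
Lemma opnorm_has_sup k l (A : 'M[R]_(k, l)) :
  has_sup [set enorm (A *m v) | v in [set v : 'cV[R]_l | enorm v <= 1]].
Proof.
split.
  exists (enorm (A *m 0)), 0 => //=; rewrite /enorm big1 ?sqrtr0// => i _.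
  by rewrite mxE expr0n.
exists (mxl1 A * l%:R) => _ [v /= v1 <-].
apply: le_trans (enorm_le_mxl1 _) _; apply: mxl1M_le => //.
apply: (@le_trans _ _ (\sum_(i < l) 1)); last by rewrite sumr_const card_ord.
apply: ler_sum => i _; rewrite big_ord1.
exact: le_trans (enorm_entry _ _) v1.
Qed.

Lemma opnorm_ge k l (A : 'M[R]_(k, l)) (v : 'cV[R]_l) :
  enorm v <= 1 -> enorm (A *m v) <= opnorm A.
Proof.
by move=> v1; apply: sup_upper_bound; [exact: opnorm_has_sup|exists v].
Qed.

Lemma opnorm_ge0 k l (A : 'M[R]_(k, l)) : 0 <= opnorm A.
Proof.
apply: le_trans (opnorm_ge A (v := 0) _); first exact: sqrtr_ge0.
by rewrite /enorm big1 ?sqrtr0// => i _; rewrite mxE expr0n.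
Qed.

(** The entry [(i, j)] is a coordinate of the image of the [j]-th basis vector. *)
Lemma mxl1_le_opnorm k l (A : 'M[R]_(k, l)) : mxl1 A <= (k * l)%:R * opnorm A.
Proof.
have Aij i j : `|A i j| <= opnorm A.
  apply: le_trans (opnorm_ge A (v := delta_mx j 0) _); last by rewrite enorm_delta_mx.
  by rewrite -colE; apply: le_trans (enorm_entry _ i); rewrite mxE.
apply: (@le_trans _ _ (\sum_(i < k) \sum_(j < l) opnorm A)).
  by apply: ler_sum => i _; apply: ler_sum.
by rewrite !sumr_const !card_ord -mulrnA mulr_natl mulnC.
Qed.

End OperatorNorm.


(** * Calculus of matrix-valued functions, entry by entry *)

Section EntrywiseCalculus.
Context {R : realType}.

Lemma within_continuousM (A : set R) (f g : R -> R) :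
  {within A, continuous f} -> {within A, continuous g} ->
  {within A, continuous (fun t => f t * g t)}.
Proof. by move=> cf cg s; apply: cvgM; [exact: cf|exact: cg]. Qed.

Lemma within_continuous_sum (A : set R) n (h : 'I_n -> R -> R) :
  (forall i, {within A, continuous (h i)}) ->
  {within A, continuous (fun t => \sum_i h i t)}.
Proof.
move=> ch; apply: (@continuous_big R 'I_n +%R 0 xpredT) => [|i _]; last exact: ch.
exact: add_continuous.
Qed.

Lemma within_continuous_abs (A : set R) (f : R -> R) :
  {within A, continuous f} -> {within A, continuous (fun t => `|f t|)}.
Proof. by move=> cf s; apply: cvg_norm; exact: cf. Qed.

Lemma within_continuous_cst (A : set R) (c : R) :
  {within A, continuous (fun _ : R => c)}.
Proof. by move=> s; exact: cvg_cst. Qed.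

Lemma derivable_within_continuous (A : set R) (f df : R -> R) :
  (forall t, is_derive t (1 : R) f (df t)) -> {within A, continuous f}.
Proof.
move=> fd; apply: continuous_subspaceT => t.
apply: differentiable_continuous; apply/derivable1_diffP.
by have [] := fd t.
Qed.

Lemma is_derive_pointwise_sum n (h : 'I_n -> R -> R) (dh : 'I_n -> R) t :
  (forall i, is_derive t (1 : R) (h i) (dh i)) ->
  is_derive t (1 : R) (fun u => \sum_i h i u) (\sum_i dh i).
Proof.
move=> hd; rewrite (_ : (fun u => _) = \sum_i h i); first exact: is_derive_sum.
by apply/funext => u; rewrite fct_sumE.
Qed.

Lemma is_derive_expRM (k s : R) :
  is_derive s (1 : R) (fun u => expR (k * u)) (k * expR (k * s)).
Proof.
rewrite mulrC; apply: is_derive1_comp.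
by rewrite -[X in is_derive _ _ _ X]mulr1; exact: is_deriveZ.
Qed.

Lemma is_derive_linM (k s : R) : is_derive s (1 : R) (fun u => k * u) k.
Proof. by rewrite -[X in is_derive _ _ _ X]mulr1; exact: is_deriveZ. Qed.

Lemma is_derive_scale (k t df : R) (f : R -> R) : is_derive t (1 : R) f df ->
  is_derive t (1 : R) (fun u => k * f u) (k * df).
Proof. by move=> fd; apply: is_deriveZ. Qed.

Lemma is_derive_mul (t df dg : R) (f g : R -> R) :
  is_derive t (1 : R) f df -> is_derive t (1 : R) g dg ->
  is_derive t (1 : R) (fun u => f u * g u) (f t * dg + g t * df).
Proof. by move=> fd gd; apply: is_deriveM. Qed.

Lemma is_derive_sub (t df dg : R) (f g : R -> R) :
  is_derive t (1 : R) f df -> is_derive t (1 : R) g dg ->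
  is_derive t (1 : R) (fun u => f u - g u) (df - dg).
Proof. by move=> fd gd; apply: is_deriveB. Qed.

Definition mx_continuous_on (T : R) k l (D : R -> 'M[R]_(k, l)) : Prop :=
  forall i j, {within `[0, T], continuous (fun t => D t i j)}.

Definition mx_is_derive k l (t : R) (D : R -> 'M[R]_(k, l)) (D' : 'M[R]_(k, l)) : Prop :=
  forall i j, is_derive t (1 : R) (fun u => D u i j) (D' i j).

Lemma mxl1_continuous (T : R) k l (D : R -> 'M[R]_(k, l)) :
  mx_continuous_on T D -> {within `[0, T], continuous (fun t => mxl1 (D t))}.
Proof.
move=> cD; apply: within_continuous_sum => i; apply: within_continuous_sum => j.
exact: within_continuous_abs.
Qed.

Lemma formE k (z : 'cV[R]_k) (M : 'M[R]_k) :
  dot z (M *m z) = \sum_i \sum_j z i 0 * z j 0 * M i j.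
Proof.
rewrite dotE; apply: eq_bigr => i _; rewrite mxE mulr_sumr.
by apply: eq_bigr => j _; rewrite -mulrA [M i j * _]mulrC.
Qed.

Lemma form_continuous (T : R) k (D : R -> 'M[R]_k) (z : 'cV[R]_k) :
  mx_continuous_on T D -> {within `[0, T], continuous (fun t => dot z (D t *m z))}.
Proof.
move=> cD.
rewrite (_ : (fun t => _) = fun t => \sum_i \sum_j z i 0 * z j 0 * D t i j).
  apply: within_continuous_sum => i; apply: within_continuous_sum => j.
  by apply: within_continuousM => //; exact: within_continuous_cst.
by apply/funext => t; rewrite formE.
Qed.

Lemma form_is_derive k (t : R) (D : R -> 'M[R]_k) D' (z : 'cV[R]_k) :
  mx_is_derive t D D' ->
  is_derive t (1 : R) (fun u => dot z (D u *m z)) (dot z (D' *m z)).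
Proof.
move=> dD; rewrite formE.
rewrite (_ : (fun u => _) = fun u => \sum_i \sum_j z i 0 * z j 0 * D u i j); last first.
  by apply/funext => u; rewrite formE.
apply: is_derive_pointwise_sum => i; apply: is_derive_pointwise_sum => j.
exact: is_derive_scale.
Qed.

Lemma trace_continuous (T : R) k (D : R -> 'M[R]_k) :
  mx_continuous_on T D -> {within `[0, T], continuous (fun t => \tr (D t))}.
Proof. by move=> cD; apply: within_continuous_sum => i; exact: cD. Qed.

Lemma trace_is_derive k (t : R) (D : R -> 'M[R]_k) D' :
  mx_is_derive t D D' -> is_derive t (1 : R) (fun u => \tr (D u)) (\tr D').
Proof. by move=> dD; apply: is_derive_pointwise_sum => i; exact: dD. Qed.

Lemma mx_continuous_onB (T : R) k l (D1 D2 : R -> 'M[R]_(k, l)) :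
  mx_continuous_on T D1 -> mx_continuous_on T D2 ->
  mx_continuous_on T (fun t => D1 t - D2 t).
Proof.
move=> c1 c2 i j.
rewrite (_ : (fun t => _) = fun t => D1 t i j - D2 t i j); last first.
  by apply/funext => t; rewrite !mxE.
by apply: within_continuousB; [exact: c1|exact: c2].
Qed.

Lemma mx_is_deriveB k l (D1 D2 : R -> 'M[R]_(k, l)) D1' D2' (t : R) :
  mx_is_derive t D1 D1' -> mx_is_derive t D2 D2' ->
  mx_is_derive t (fun t => D1 t - D2 t) (D1' - D2').
Proof.
move=> d1 d2 i j.
rewrite (_ : (fun t => _) = fun t => D1 t i j - D2 t i j); last first.
  by apply/funext => s; rewrite !mxE.
by rewrite !mxE; apply: is_derive_sub.
Qed.

Lemma mx_continuous_onT (T : R) k l (D : R -> 'M[R]_(k, l)) :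
  mx_continuous_on T D -> mx_continuous_on T (fun t => (D t)^T).
Proof.
move=> cD i j; rewrite (_ : (fun t => _) = fun t => D t j i)//.
by apply/funext => t; rewrite mxE.
Qed.

Lemma mx_is_deriveT k l (D : R -> 'M[R]_(k, l)) D' (t : R) :
  mx_is_derive t D D' -> mx_is_derive t (fun t => (D t)^T) D'^T.
Proof.
move=> dD i j; rewrite (_ : (fun t => _) = fun t => D t j i).
  by rewrite mxE.
by apply/funext => s; rewrite mxE.
Qed.

Lemma mx_continuous_on_bounded (T : R) k l (D : R -> 'M[R]_(k, l)) : 0 <= T ->
  mx_continuous_on T D -> exists rho, forall t : R, 0 <= t <= T -> mxl1 (D t) <= rho.
Proof.
move=> T0 /mxl1_continuous/(EVT_max T0)[c _ H]; exists (mxl1 (D c)) => t tT.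
by apply: H; rewrite in_itv.
Qed.

End EntrywiseCalculus.

(** * Gronwall's inequality and continuation in time *)

Section DifferentialInequalities.
Context {R : realType}.
Implicit Types (f : R -> R) (T a b c t : R).

Lemma gronwall f T b c : 0 <= b -> 0 <= c ->
  {within `[0, T], continuous f} ->
  (forall t, 0 < t < T -> exists2 d, is_derive t (1 : R) f d & d <= c * f t + b) ->
  forall t, 0 <= t <= T -> f t <= (f 0 + b * t) * expR (c * t).
Proof.
move=> b0 c0 cf df t /andP[t0 tT].
(* As the weight [expR (- c * u)] is at most 1, subtracting [b * u] absorbs
   the constant term, and [h] decreases. *)
pose h (u : R) := f u * expR (- c * u) - b * u.
have dh s : 0 < s < T -> exists2 d, is_derive s (1 : R) h d & d <= 0.
  move=> /[dup] /andP[s0 sT] /df[d fd dle].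
  eexists.
    exact (is_derive_sub (is_derive_mul fd (is_derive_expRM (- c) s))
      (is_derive_linM b s)).
  have e1 : expR (- c * s) <= 1 by rewrite expR_le1; nra.
  have e0 := expR_gt0 (- c * s); nra.
have : h t <= h 0.
  apply: (@ler0_derive1_le_cc R h 0 T) => //.
  - by move=> s; rewrite in_itv/= => /dh[d hd _]; exact: ex_derive.
  - by move=> s; rewrite in_itv/= => /dh[d hd d0]; rewrite derive1E derive_val.
  - apply: within_continuousB.
      apply: within_continuousM => //.
      exact: derivable_within_continuous (is_derive_expRM (- c)).
    exact: derivable_within_continuous (is_derive_linM b).
  - by rewrite in_itv/= t0 tT.
  - by rewrite in_itv/= lexx (le_trans t0).
rewrite /h mulr0 expR0 mulr1 mulr0 subr0 lerBlDr.
rewrite -(ler_pM2r (expR_gt0 (c * t))) -mulrA -expRD.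
by rewrite mulNr addNr expR0 mulr1.
Qed.

End DifferentialInequalities.
Section LocalToGlobal.
Context {R : realType}.
Implicit Types (f : R -> R) (T t : R).

Lemma within_continuous_eps f T t e : {within `[0, T], continuous f} ->
  0 <= t <= T -> 0 < e ->
  exists2 d, 0 < d &
    forall s, 0 <= s <= T -> `|s - t| < d -> `|f s - f t| < e.
Proof.
move=> /subspace_continuousP/(_ t) cf tT e0.
have /cvgrPdist_lt/(_ _ e0) : f x @[x --> within `[0, T] (nbhs t)] --> f t.
  by apply: cf; rewrite /= in_itv.
rewrite near_withinE => /nbhs_ballP[d d0 H].
exists d => // s sT sd; rewrite distrC; apply: H.
  by rewrite /ball/= distrC.
by rewrite /= in_itv.
Qed.

Lemma within_continuous_ge0 f T t : {within `[0, T], continuous f} ->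
  0 < t <= T -> (forall s, 0 <= s < t -> 0 <= f s) -> 0 <= f t.
Proof.
move=> cf /andP[t0 tT] fs; rewrite leNgt; apply/negP => ft.
have [||d d0 H] := within_continuous_eps (t := t) (e := - f t) cf.
- by rewrite ltW.
- by rewrite oppr_gt0.
pose h := Num.min (d / 2) (t / 2).
have h0 : 0 < h by rewrite lt_min !divr_gt0.
have [hd ht] : h < d /\ h < t.
  by split; rewrite gt_min; apply/orP; [left|right]; lra.
have := H (t - h); have -> : t - h - t = - h by ring.
rewrite normrN gtr0_norm// => /(_ _ hd) => K.
have /K : 0 <= t - h <= T by apply/andP; split; lra.
have := fs (t - h); have -> : 0 <= t - h < t by apply/andP; split; lra.
by move=> /(_ isT) f0; rewrite ger0_norm; lra.
Qed.

(** The infimum of the failure times is itself not a failure time, by the first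
    two hypotheses, and failures cannot accumulate at it, by the third. *)
Lemma real_induction (P : R -> Prop) T :
  P 0 ->
  (forall t, 0 < t <= T -> (forall s, 0 <= s < t -> P s) -> P t) ->
  (forall t, 0 <= t < T -> (forall s, 0 <= s <= t -> P s) ->
     exists2 d, 0 < d & forall s, t < s < t + d -> s <= T -> P s) ->
  forall t, 0 <= t <= T -> P t.
Proof.
move=> P0 Pclosed Popen t tT; apply: contrapT => nPt.
pose B := [set s : R | 0 <= s <= T /\ ~ P s].
have Bt : B t by [].
have lbB : has_lbound B by exists 0 => s [/andP[]].
pose i := inf B.
have i0 : 0 <= i by apply: lb_le_inf; [exists t|move=> s [/andP[]]].
have it : i <= t by apply: ge_inf.
have iT : i <= T by case/andP: tT => _; apply: le_trans.
have Plt s : 0 <= s < i -> P s.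
  move=> /andP[s0 si]; apply: contrapT => nPs.
  suff : i <= s by rewrite leNgt si.
  by apply: ge_inf => //; split=> //; rewrite s0 (le_trans (ltW si)).
have Pi : P i.
  move: i0; rewrite le_eqVlt => /predU1P[<-//|i0].
  by apply: Pclosed => //; rewrite i0.
have Ple s : 0 <= s <= i -> P s.
  by rewrite [s <= i]le_eqVlt => /andP[s0 /predU1P[->//|si]]; apply: Plt; rewrite s0.
have iltT : i < T.
  rewrite lt_neqAle iT andbT; apply/eqP => iE.
  by apply: nPt; apply: Ple; rewrite iE.
have [|d d0 Pd] := Popen i _ Ple; first by rewrite i0.
have [s [/andP[s0 sT] nPs] sid] : exists2 s, B s & s < i + d.
  by apply: inf_lt; [exists t|rewrite ltrDl].
apply: nPs; have [si|si] := leP s i; first by apply: Ple; rewrite s0.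
by apply: Pd => //; rewrite si.
Qed.

(** The difference quotient with a negative increment is nonpositive. *)
Lemma derive_le0_of_min_right f t d : 0 < t ->
  is_derive t (1 : R) f d -> (forall s, 0 <= s < t -> 0 <= f s) -> f t = 0 ->
  d <= 0.
Proof.
move=> t0 [df dfd] fs ft; rewrite leNgt; apply/negP => d0.
have : (fun h : R => h^-1 *: ((f \o shift t) (h *: (1 : R)) - f t)) @ 0^' --> d.
  by rewrite -dfd; exact: df.
move=> /cvgr_gt/(_ _ d0) /nbhs_ballP[e /= e0 H].
pose h := Num.min (e / 2) (t / 2).
have h0 : 0 < h by rewrite lt_min !divr_gt0.
have [he ht] : h < e /\ h < t.
  by split; rewrite gt_min; apply/orP; [left|right]; lra.
have : 0 < (- h)^-1 *: ((f \o shift t) (- h *: (1 : R)) - f t).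
  apply: (H (- h)); last by rewrite oppr_eq0 gt_eqF.
  by rewrite /ball/= sub0r opprK gtr0_norm.
rewrite /= ft subr0 /GRing.scale/= mulr1 invrN mulNr oppr_gt0 pmulr_rlt0 ?invr_gt0//.
rewrite ltNge fs//; apply/andP; split; lra.
Qed.

End LocalToGlobal.

Section MatrixGronwall.
Context {R : realType}.

(** Gronwall's inequality is applied to the sum of the squared entries, which
    is differentiable, unlike [mxl1].  The constant is chosen before the
    function, as uniformity in the data requires. *)
Lemma mx_gronwall (T : R) k l (c : R) : 0 <= T -> 0 <= c ->
  exists2 K, 0 < K & forall (D D' : R -> 'M[R]_(k, l)) (b : R),
    0 <= b -> mx_continuous_on T D ->
    (forall t : R, 0 < t < T -> mx_is_derive t D (D' t)) ->
    (forall t : R, 0 < t < T -> mxl1 (D' t) <= c * mxl1 (D t) + b) ->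
    forall t : R, 0 <= t <= T -> mxl1 (D t) <= K * (mxl1 (D 0) + b).
Proof.
move=> T0 c0; pose p : R := (k * l)%:R; pose c' := (2 * c + 1) * p.
have p0 : 0 <= p by [].
have c'0 : 0 <= c' by rewrite mulr_ge0//; lra.
pose K2 := p * (1 + T) * expR (c' * T).
have K20 : 0 <= K2 by rewrite !mulr_ge0 ?expR_ge0//; lra.
exists (1 + K2) => [|D D' b b0 cD dD D'le t tT]; first by lra.
pose f s := \sum_i \sum_j D s i j ^+ 2.
have fle s : mxl1 (D s) ^+ 2 <= p * f s by exact: mxl1_sqr_le_sum.
have H : f t <= (f 0 + b ^+ 2 * t) * expR (c' * t).
  apply: (gronwall (T := T)) => //; first by rewrite sqr_ge0.
    rewrite (_ : f = fun s => \sum_i \sum_j D s i j * D s i j); last exact/funext.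
    apply: within_continuous_sum => i; apply: within_continuous_sum => j.
    by apply: within_continuousM; exact: cD.
  move=> s sT; exists (\sum_i \sum_j (D s i j * D' s i j + D s i j * D' s i j)).
    rewrite (_ : f = fun s => \sum_i \sum_j D s i j * D s i j); last exact/funext.
    apply: is_derive_pointwise_sum => i; apply: is_derive_pointwise_sum => j.
    by apply: is_derive_mul; exact: dD.
  have : \sum_i \sum_j (D s i j * D' s i j + D s i j * D' s i j) <=
         2 * (mxl1 (D s) * mxl1 (D' s)).
    have -> : 2 * (mxl1 (D s) * mxl1 (D' s)) =
       \sum_i \sum_j (2 * `|D s i j| * mxl1 (D' s)).
      have -> : 2 * (mxl1 (D s) * mxl1 (D' s)) =
          (\sum_i \sum_j 2 * `|D s i j|) * mxl1 (D' s).
        rewrite mulrA; congr (_ * _); rewrite /mxl1 mulr_sumr.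
        by apply: eq_bigr => i _; rewrite mulr_sumr.
      by rewrite mulr_suml; apply: eq_bigr => i _; rewrite mulr_suml.
    apply: ler_sum => i _; apply: ler_sum => j _.
    have := ler_norm (D s i j * D' s i j); rewrite normrM.
    have : `|D s i j| * `|D' s i j| <= `|D s i j| * mxl1 (D' s).
      by rewrite ler_wpM2l// mxl1_entry.
    lra.
  have := D'le s sT; have := fle s; have := mxl1_ge0 (D s).
  rewrite /c'; set N := mxl1 (D s); set N' := mxl1 (D' s).
  move=> N0 NF N'le; move/le_trans; apply.
  have NN' : N * N' <= N * (c * N + b) by rewrite ler_wpM2l.
  have NN : (2 * c + 1) * N ^+ 2 <= (2 * c + 1) * (p * f s).
    by rewrite ler_wpM2l//; lra.
  have := sqr_ge0 (N - b); nra.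
have Ht : mxl1 (D t) ^+ 2 <= K2 * (mxl1 (D 0) + b) ^+ 2.
  apply: le_trans (fle t) _; rewrite /K2 -!mulrA ler_wpM2l//.
  apply: le_trans H _; rewrite mulrA [leRHS]mulrC [leRHS]mulrA.
  have /andP[t0 tleT] := tT.
  apply: ler_pM; rewrite ?expR_ge0//.
  - rewrite addr_ge0//; last by rewrite mulr_ge0 ?sqr_ge0.
    by apply: sumr_ge0 => i _; apply: sumr_ge0 => j _; rewrite sqr_ge0.
  - have : f 0 <= mxl1 (D 0) ^+ 2 by exact: sum_sqr_le_mxl1.
    have := mxl1_ge0 (D 0); set N := mxl1 (D 0) => N0 fN.
    have : b ^+ 2 * t <= (N + b) ^+ 2 * T.
      by apply: ler_pM => //; rewrite ?sqr_ge0// lerXn2r ?nnegrE ?lerDr ?addr_ge0.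
    have : N ^+ 2 <= (N + b) ^+ 2 by rewrite lerXn2r ?nnegrE ?lerDl ?addr_ge0.
    nra.
  - by rewrite ler_expR mulrA ler_wpM2l.
have N0 : 0 <= mxl1 (D 0) + b by rewrite addr_ge0 ?mxl1_ge0.
rewrite -(ler_pXn2r (n := 2))//; first last.
- by rewrite nnegrE mulr_ge0//; lra.
- by rewrite nnegrE mxl1_ge0.
apply: le_trans Ht _; rewrite exprMn ler_wpM2r ?sqr_ge0//; nra.
Qed.

End MatrixGronwall.

(** * Propagation of Lipschitz bounds through matrix expressions *)

Section PairwiseBounds.
Context {R : realType}.

(** The norm bound [a] and the Lipschitz factor [c] travel together because the
    Lipschitz factor of a product needs the norms of its factors.  Closure under
    the matrix operations then lets unification compute the constants of
    a compound expression. *)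
Definition close_pair k l (a c eta : R) (X1 X2 : 'M[R]_(k, l)) : Prop :=
  [/\ mxl1 X1 <= a, mxl1 X2 <= a & mxl1 (X1 - X2) <= c * eta].

Variable eta : R.
Hypothesis eta0 : 0 <= eta.

Lemma close_pair_refl k l a (X : 'M[R]_(k, l)) :
  mxl1 X <= a -> close_pair a 0 eta X X.
Proof. by split=> //; rewrite subrr mxl10 mul0r. Qed.

Lemma close_pairT k l a c (X1 X2 : 'M[R]_(k, l)) :
  close_pair a c eta X1 X2 -> close_pair a c eta X1^T X2^T.
Proof. by move=> [h1 h2 h3]; split; rewrite -?linearB/= mxl1T. Qed.

Lemma close_pairD k l a1 c1 a2 c2 (X1 X2 Y1 Y2 : 'M[R]_(k, l)) :
  close_pair a1 c1 eta X1 X2 -> close_pair a2 c2 eta Y1 Y2 ->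
  close_pair (a1 + a2) (c1 + c2) eta (X1 + Y1) (X2 + Y2).
Proof.
move=> [h1 h2 h3] [k1 k2 k3]; split; try exact: mxl1D_le.
by rewrite opprD addrACA mulrDl mxl1D_le.
Qed.

Lemma close_pairB k l a1 c1 a2 c2 (X1 X2 Y1 Y2 : 'M[R]_(k, l)) :
  close_pair a1 c1 eta X1 X2 -> close_pair a2 c2 eta Y1 Y2 ->
  close_pair (a1 + a2) (c1 + c2) eta (X1 - Y1) (X2 - Y2).
Proof.
move=> hX [k1 k2 k3]; apply: close_pairD => //.
by split; rewrite ?mxl1N// -opprD mxl1N.
Qed.

Lemma close_pairM k l p a1 c1 a2 c2 (X1 X2 : 'M[R]_(k, l)) (Y1 Y2 : 'M[R]_(l, p)) :
  close_pair a1 c1 eta X1 X2 -> close_pair a2 c2 eta Y1 Y2 ->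
  close_pair (a1 * a2) (a1 * c2 + c1 * a2) eta (X1 *m Y1) (X2 *m Y2).
Proof.
move=> [h1 h2 h3] [k1 k2 k3]; split; try exact: mxl1M_le.
have -> : X1 *m Y1 - X2 *m Y2 = X1 *m (Y1 - Y2) + (X1 - X2) *m Y2.
  by rewrite mulmxBr mulmxBl addrA subrK.
have -> : (a1 * c2 + c1 * a2) * eta = a1 * (c2 * eta) + (c1 * eta) * a2 by ring.
by apply: mxl1D_le; apply: mxl1M_le.
Qed.

Lemma close_pairV k a c (X1 X2 : 'M[R]_k) : X1 \in unitmx -> X2 \in unitmx ->
  mxl1 (invmx X1) <= a -> mxl1 (invmx X2) <= a -> mxl1 (X1 - X2) <= c * eta ->
  close_pair a (a * c * a) eta (invmx X1) (invmx X2).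
Proof.
move=> u1 u2 h1 h2 h3; split=> //.
have -> : invmx X1 - invmx X2 = invmx X1 *m (X2 - X1) *m invmx X2.
  by rewrite mulmxBr mulmxBl mulVmx// mul1mx -mulmxA mulmxV// mulmx1.
have -> : a * c * a * eta = (a * (c * eta)) * a by ring.
by apply: mxl1M_le => //; apply: mxl1M_le => //; rewrite -mxl1N opprB.
Qed.

End PairwiseBounds.

(** * Bounds for the Riccati equation *)

Definition riccati_rhs (R : realType) n m r (B : 'M[R]_(n, m)) (C : 'M[R]_(r, n))
    (S : quadruple R n m r) (X : 'M[R]_n) : 'M[R]_n :=
  let: (A, G, W, Q) := S in
  A *m X + X *m A^T - X *m C^T *m invmx Q *m C *m X + B *m W *m B^T.

Definition entries_bounded_by (R : realType) n m r (beta : R)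
    (S : quadruple R n m r) : Prop :=
  let: (A, G, W, Q) := S in
  [/\ mxl1 A <= beta, mxl1 G <= beta /\ mxl1 (invmx G) <= beta,
      mxl1 W <= beta & mxl1 (invmx Q) <= beta].

Definition quad_dist (R : realType) n m r (S1 S2 : quadruple R n m r) : R :=
  let: (A, G, W, Q) := S1 - S2 in mxl1 A + mxl1 G + mxl1 W + mxl1 Q.

Section Riccati.
Context {R : realType} {n m r : nat}.
Variables (T : R) (B : 'M[R]_(n, m)) (C : 'M[R]_(r, n)).
Hypothesis T0 : 0 <= T.
Implicit Types (S : quadruple R n m r) (Pi : R -> 'M[R]_n) (beta rho : R).

Lemma quad_dist_ge0 S1 S2 : 0 <= quad_dist S1 S2.
Proof.
by rewrite /quad_dist; case: (S1 - S2) => [[[A G] W] Q]; rewrite !addr_ge0 ?mxl1_ge0.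
Qed.

Lemma quad_dist0 S : quad_dist S S = 0.
Proof. by rewrite /quad_dist subrr/= !mxl10 !addr0. Qed.

(** The right-hand side is quadratic in [X], hence Lipschitz only on bounded
    sets: this is where [rho] enters. *)
Lemma riccati_rhs_lipschitz beta rho : exists2 c, 0 < c &
  forall S1 S2 X1 X2, admissible S1 -> admissible S2 ->
    entries_bounded_by beta S1 -> entries_bounded_by beta S2 ->
    mxl1 X1 <= rho -> mxl1 X2 <= rho ->
    mxl1 (riccati_rhs B C S1 X1 - riccati_rhs B C S2 X2) <=
      c * (mxl1 (X1 - X2) + quad_dist S1 S2).
Proof.
suff [c H] : exists c, forall S1 S2 X1 X2, admissible S1 -> admissible S2 ->
    entries_bounded_by beta S1 -> entries_bounded_by beta S2 ->
    mxl1 X1 <= rho -> mxl1 X2 <= rho ->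
    mxl1 (riccati_rhs B C S1 X1 - riccati_rhs B C S2 X2) <=
      c * (mxl1 (X1 - X2) + quad_dist S1 S2).
  exists (`|c| + 1) => [|S1 S2 X1 X2 a1 a2 b1 b2 x1 x2].
    by rewrite ltr_wpDl.
  apply: le_trans (H S1 S2 X1 X2 a1 a2 b1 b2 x1 x2) _.
  rewrite ler_wpM2r ?addr_ge0 ?mxl1_ge0 ?quad_dist_ge0//.
  by apply: le_trans (ler_norm _) _; rewrite lerDl.
(* The constant is left open and read off the composed bounds at the end. *)
eexists => -[[[A1 G1] W1] Q1] [[[A2 G2] W2] Q2] X1 X2 [_ _ sQ1] [_ _ sQ2].
move=> [A1b _ W1b Q1b] [A2b _ W2b Q2b] X1b X2b.
pose eta : R := mxl1 (X1 - X2) +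
  @quad_dist R n m r (A1, G1, W1, Q1) (A2, G2, W2, Q2).
have [dA dW dQ dX] : [/\ mxl1 (A1 - A2) <= 1 * eta, mxl1 (W1 - W2) <= 1 * eta,
    mxl1 (Q1 - Q2) <= 1 * eta & mxl1 (X1 - X2) <= 1 * eta].
  have := (mxl1_ge0 (A1 - A2), mxl1_ge0 (G1 - G2), mxl1_ge0 (W1 - W2), mxl1_ge0 (Q1 - Q2)).
  move=> [[[a g] w] q]; have := mxl1_ge0 (X1 - X2).
  by rewrite /eta /quad_dist/= !mul1r => x; split; lra.
have pA : close_pair beta 1 eta A1 A2 by [].
have pW : close_pair beta 1 eta W1 W2 by [].
have pX : close_pair rho 1 eta X1 X2 by [].
have pQ := close_pairV (spd_unit sQ1) (spd_unit sQ2) Q1b Q2b dQ.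
have pC := close_pair_refl eta (lexx (mxl1 C)).
have pB := close_pair_refl eta (lexx (mxl1 B)).
have [_ _] := close_pairD (close_pairB (close_pairD (close_pairM pA pX)
    (close_pairM pX (close_pairT pA)))
  (close_pairM (close_pairM (close_pairM (close_pairM pX (close_pairT pC)) pQ) pC) pX))
  (close_pairM (close_pairM pB pW) (close_pairT pB)).
exact.
Qed.

Lemma riccati_rhs_trmx S X : admissible S ->
  (riccati_rhs B C S X)^T = riccati_rhs B C S X^T.
Proof.
case: S => [[[A G] W] Q] [_ [Ws _] [Qs _]]; rewrite /riccati_rhs.
rewrite !linearD/= linearN/= !trmx_mul !trmxK Ws trmx_inv Qs !mulmxA.
by rewrite [A *m X^T + _]addrC.
Qed.

Lemma riccati_solutionE S Pi : riccati_solution T B C S Pi <->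
  [/\ Pi 0 = S.1.1.2, mx_continuous_on T Pi &
      forall t : R, 0 < t < T -> mx_is_derive t Pi (riccati_rhs B C S (Pi t))].
Proof. by case: S => [[[A G] W] Q]. Qed.

(** The transpose of a solution solves the same equation, with the same initial
    value, so it is the same solution; the local Lipschitz constant comes from
    a bound on this particular [Pi]. *)
Lemma riccati_symmetric S Pi : admissible S -> riccati_solution T B C S Pi ->
  forall t : R, 0 <= t <= T -> (Pi t)^T = Pi t.
Proof.
move=> Sadm /riccati_solutionE[Pi0 cPi dPi] t tT.
have [rho Pib] := mx_continuous_on_bounded T0 cPi.
have [beta Sb] : exists beta, entries_bounded_by beta S.
  case: S {Sadm Pi0 dPi} => [[[A G] W] Q].
  exists (mxl1 A + mxl1 G + mxl1 (invmx G) + mxl1 W + mxl1 (invmx Q)).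
  have := (mxl1_ge0 A, mxl1_ge0 G, mxl1_ge0 (invmx G), mxl1_ge0 W, mxl1_ge0 (invmx Q)).
  by move=> [[[[a g] g'] w] q]; split; [lra|split; lra|lra|lra].
have [c c0 H] := riccati_rhs_lipschitz beta rho.
have [K _ gron] := mx_gronwall n n T0 (ltW c0).
have := gron (fun t => Pi t - (Pi t)^T)
  (fun t => riccati_rhs B C S (Pi t) - (riccati_rhs B C S (Pi t))^T) 0 (lexx 0).
have -> : Pi 0 - (Pi 0)^T = 0.
  case: S Sadm Pi0 {Sb dPi} => [[[A G] W] Q] [[Gs _] _ _] -> /=.
  by rewrite Gs subrr.
rewrite mxl10 addr0 mulr0 => D0; apply/esym/eqP; rewrite -subr_eq0; apply/eqP.
apply/mxl1_eq0/D0 => //.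
- by apply: mx_continuous_onB => //; apply: mx_continuous_onT.
- move=> s sT; apply: mx_is_deriveB; first exact: dPi.
  by apply: mx_is_deriveT; exact: dPi.
- move=> s /andP[/ltW s0 /ltW sT]; rewrite addr0 riccati_rhs_trmx//.
  have sI : 0 <= s <= T by rewrite s0.
  have := H S S (Pi s) (Pi s)^T Sadm Sadm Sb Sb (Pib s sI).
  by rewrite quad_dist0 addr0 mxl1T; apply; exact: Pib.
Qed.

End Riccati.

Section RiccatiBounds.
Context {R : realType} {n m r : nat}.
Variables (T : R) (B : 'M[R]_(n, m)) (C : 'M[R]_(r, n)).
Hypothesis T0 : 0 <= T.
Implicit Types (S : quadruple R n m r) (Pi : R -> 'M[R]_n) (beta rho : R).

(** Along an eigenvector with eigenvalue [psi] the terms linear in [X] are of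
    order [psi] and the quadratic one of order [psi ^+ 2], which [psi <= 1]
    absorbs; the term in [W] is nonnegative. *)
Lemma riccati_rhs_eigen beta S (X : 'M[R]_n) (z : 'cV[R]_n) (psi : R) :
  admissible S -> entries_bounded_by beta S -> 0 <= beta -> 0 <= psi -> psi <= 1 ->
  X^T = X -> X *m z = psi *: z ->
  - (n%:R * (2 * beta + mxl1 C * beta * mxl1 C)) * psi * dot z z <=
  dot z (riccati_rhs B C S X *m z).
Proof.
case: S => [[[A G] W] Q] [_ /spd_psd Wp /[dup] sQ /spd_psd Qp] [Ab _ _ Qb] b0 p0 p1 Xs Xz.
set q := dot z z; have q0 : 0 <= q by exact: dot_ge0.
have zX w : dot z (X *m w) = psi * dot z w by rewrite dot_mulmx Xs Xz dotZl.
have -> : dot z (riccati_rhs B C (A, G, W, Q) X *m z) =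
    2 * psi * dot z (A *m z) - psi ^+ 2 * dot z (C^T *m invmx Q *m C *m z)
    + dot z (B *m W *m B^T *m z).
  rewrite /riccati_rhs !mulmxDl !dotDr mulNmx dotNr; congr (_ - _ + _).
    rewrite -!mulmxA Xz zX -scalemxAr dotZr [dot z (A^T *m z)]dot_mulmx trmxK.
    by rewrite (dotC (A *m z)); ring.
  by rewrite -!mulmxA zX Xz -!scalemxAr dotZr; ring.
have zA : - (n%:R * beta * q) <= dot z (A *m z).
  have := form_le A z; rewrite ler_norml => /andP[+ _]; apply: le_trans.
  by rewrite lerN2 ler_wpM2r// ler_wpM2l.
have zK : dot z (C^T *m invmx Q *m C *m z) <= n%:R * (mxl1 C * beta * mxl1 C) * q.
  apply: le_trans (ler_norm _) _; apply: le_trans (form_le _ _) _.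
  by rewrite ler_wpM2r// ler_wpM2l// mxl1M_le// mxl1M_le// mxl1T.
have zW : 0 <= dot z (B *m W *m B^T *m z).
  by have [_] := psd_congr B^T Wp; rewrite trmxK; exact.
have p2 : psi ^+ 2 <= psi by rewrite expr2; nra.
set a := dot z (A *m z) in zA *; set k := dot z (_ *m C *m z) in zK *.
have k1 : psi ^+ 2 * k <= psi * (n%:R * (mxl1 C * beta * mxl1 C) * q).
  apply: (@le_trans _ _ (psi ^+ 2 * (n%:R * (mxl1 C * beta * mxl1 C) * q))).
    by rewrite ler_wpM2l// sqr_ge0.
  by rewrite ler_wpM2r// !mulr_ge0// mxl1_ge0.
have a1 : psi * (- (n%:R * beta * q)) <= psi * a by rewrite ler_wpM2l.
nra.
Qed.

(** The comparison function [psi] starts at half the lower bound of [Gamma], so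
    that the form of [Pi - psi I] is positive definite at time 0, and decays
    fast enough to beat the growth rate [- k] of [riccati_rhs_eigen].  A
    positive semidefinite [Pi t - psi t I] is then invertible, hence coercive by
    [psd_unit_lower], and coercivity persists for a short time by continuity. *)
Lemma riccati_lower beta : 1 <= beta -> exists2 a, 0 < a &
  forall S Pi, admissible S -> entries_bounded_by beta S ->
    riccati_solution T B C S Pi ->
    forall t : R, 0 <= t <= T -> forall z, a * dot z z <= dot z (Pi t *m z).
Proof.
move=> b1; pose N : R := n.+1%:R.
have N1 : 1 <= N by rewrite ler1n.
have nN : n%:R <= N by rewrite ler_nat.
(* [n.+1] rather than [n], so that [eps] makes sense in dimension 0 *)
pose eps := (2 * (N * beta))^-1.
have Nb : 1 <= N * beta by rewrite mulr_ege1.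
have eps0 : 0 < eps by rewrite invr_gt0; lra.
have eps1 : eps <= 1 by rewrite invf_le1; lra.
have epsE : 2 * eps * (N * beta) = 1.
  by rewrite /eps; field; rewrite !gt_eqF//; lra.
pose k := n%:R * (2 * beta + mxl1 C * beta * mxl1 C).
have k0 : 0 <= k.
  by rewrite mulr_ge0// addr_ge0// ?mulr_ge0 ?mxl1_ge0//; lra.
pose psi t := eps * expR (- (k + 1) * t).
have psi0 t : 0 < psi t by rewrite mulr_gt0 ?expR_gt0.
have psi1 t : 0 <= t -> psi t <= 1.
  move=> t0; apply: le_trans eps1; rewrite /psi ler_piMr ?(ltW eps0)// expR_le1.
  by nra.
have dpsi t : is_derive t (1 : R) psi (- (k + 1) * psi t).
  rewrite /psi mulrCA; apply: is_derive_scale; exact: is_derive_expRM.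
exists (psi T) => // S Pi Sadm Sb sol.
have Pis := riccati_symmetric T0 Sadm sol.
have [Pi0 cPi dPi] := (riccati_solutionE T B C S Pi).1 sol.
pose g z t := dot z (Pi t *m z) - psi t * dot z z.
have gE z t : g z t = dot z ((Pi t - (psi t)%:M) *m z) by rewrite form_scalar_sub.
have cg z : {within `[0, T], continuous (g z)}.
  apply: within_continuousB; first exact: form_continuous.
  apply: within_continuousM; last exact: within_continuous_cst.
  exact: derivable_within_continuous dpsi.
suff H t : 0 <= t <= T -> forall z, 0 <= g z t.
  move=> t tT z; have := H t tT z; rewrite subr_ge0; apply: le_trans.
  rewrite ler_wpM2r ?dot_ge0// /psi ler_wpM2l ?(ltW eps0)// ler_expR.
  by case/andP: tT => t0 tT; nra.
have g00 z : eps * dot z z <= g z 0.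
  rewrite /g /psi mulr0 expR0 mulr1 Pi0.
  case: S Sadm Sb {sol Pis Pi0 dPi} => [[[A G] W] Q] [sG _ _] [_ [_ Gb] _ _] /=.
  have := psd_unit_lower z (spd_psd sG) (spd_unit sG).
  have [_ /(_ z)] := spd_psd sG; set p := dot z (G *m z) => p0.
  have : n%:R * mxl1 (invmx G) * p <= N * beta * p.
    by rewrite ler_wpM2r// ler_pM// mxl1_ge0.
  move=> h1 h2; have : dot z z <= N * beta * p by exact: le_trans h1.
  by have := dot_ge0 z; nra.
move: t; apply: real_induction.
- move=> z; apply: le_trans (g00 z).
  by rewrite mulr_ge0 ?dot_ge0// ltW.
- move=> t tT Hs z; apply: (within_continuous_ge0 (T := T)) => // s st.
  exact: Hs.
- move=> t /andP[t0 tT] Hs.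
  have tI : 0 <= t <= T by rewrite t0 ltW.
  have Ms := trmx_scalar_sub (psi t) (Pis t tI).
  have Mpsd : psd (Pi t - (psi t)%:M).
    by split=> // z; rewrite -gE; apply: Hs; rewrite t0 lexx.
  have Mu : Pi t - (psi t)%:M \in unitmx.
    (* A null vector [z] at a positive time would make [g z] vanish there with
       positive derivative, hence be negative just before. *)
    move: t0; rewrite le_eqVlt => /predU1P[t0|t0].
      by apply: (form_lower_unit Ms eps0) => z; rewrite -gE -t0.
    apply: contraT => /(nonunit_null_vector Ms)[z z0 Mz].
    have gz : g z t = 0 by rewrite gE Mz /dot mulmx0 mxE.
    have Piz : Pi t *m z = psi t *: z.
      by apply/eqP; rewrite -subr_eq0 -mul_scalar_mx -mulmxBl Mz.
    have tI' : 0 < t < T by rewrite t0.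
    have dg := is_derive_sub (form_is_derive z (dPi t tI'))
      (is_derive_mul (dpsi t) (is_derive_cst (dot z z) t (1 : R))).
    have := derive_le0_of_min_right t0 dg.
    have Hs' s : 0 <= s < t -> 0 <= g z s.
      by move=> /andP[s0 st]; apply: Hs; rewrite s0 ltW.
    move=> /(_ Hs' gz).
    have := riccati_rhs_eigen Sadm Sb _ (ltW (psi0 t)) (psi1 t (ltW t0)) (Pis t tI) Piz.
    have beta0 : 0 <= beta by lra.
    move=> /(_ beta0); rewrite -/k.
    have := mulr_gt0 (psi0 t) (dot_gt0 z0).
    set q := dot z z; set p := psi t; set d := dot z (_ *m z); rewrite /cst.
    by rewrite mulr0 add0r; nra.
  have [c c1 Hc] : exists2 c : R, 0 < c & forall z, dot z z <= c * g z t.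
    exists (n%:R * mxl1 (invmx (Pi t - (psi t)%:M)) + 1) => [|z].
      by rewrite ltr_wpDl// mulr_ge0// mxl1_ge0.
    have := psd_unit_lower z Mpsd Mu; rewrite -gE.
    by have := Hs t _ z; rewrite t0 lexx => /(_ isT); lra.
  have cM : mx_continuous_on T (fun s => Pi s - (psi s)%:M).
    apply: mx_continuous_onB => // i j.
    rewrite (_ : (fun s => _) = fun s => psi s * (i == j)%:R).
      apply: within_continuousM; last exact: within_continuous_cst.
      exact: derivable_within_continuous dpsi.
    by apply/funext => s; rewrite mxE mulr_natr.
  have cMt : mx_continuous_on T (fun _ : R => Pi t - (psi t)%:M).
    by move=> i j; exact: within_continuous_cst.
  have := mxl1_continuous (mx_continuous_onB cM cMt).
  move=> /within_continuous_eps/(_ tI).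
  have e0 : 0 < (N * c)^-1 by rewrite invr_gt0 mulr_gt0//; lra.
  move=> /(_ _ e0)[d d0 Hd]; exists d => // s /andP[ts std] sT z.
  have sI : 0 <= s <= T by rewrite sT (le_trans t0 (ltW ts)).
  have sd : `|s - t| < d by rewrite gtr0_norm; lra.
  have := Hd s sI sd; rewrite subrr mxl10 subr0 ger0_norm ?mxl1_ge0//.
  set E := _ - _ => Eb.
  have -> : g z s = g z t + dot z (E *m z).
    by rewrite !gE -dotDr -mulmxDl /E [X in _ = dot z (X *m z)]addrC subrK.
  have := form_le E z; rewrite ler_norml => /andP[+ _].
  have : n%:R * mxl1 E * dot z z <= c^-1 * dot z z.
    rewrite ler_wpM2r ?dot_ge0//.
    apply: (@le_trans _ _ (N * (N * c)^-1)).
      by rewrite ler_pM ?mxl1_ge0// ltW.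
    by rewrite invfM mulrA mulfV ?mul1r// gt_eqF//; lra.
  have : c^-1 * dot z z <= g z t.
    by rewrite mulrC ler_pdivrMr// mulrC.
  lra.
Qed.

(** The trace satisfies [f' <= 2 * beta * n^2 * f + b]: the quadratic term has
    a nonnegative trace, and [mxl1_psd_le] bounds the linear terms. *)
Lemma riccati_upper beta : 1 <= beta -> exists2 rho, 0 < rho &
  forall S Pi, admissible S -> entries_bounded_by beta S ->
    riccati_solution T B C S Pi ->
    forall t : R, 0 <= t <= T -> mxl1 (Pi t) <= rho.
Proof.
move=> b1; have [a a0 low] := riccati_lower b1.
pose N : R := (n * n)%:R; have N0 : 0 <= N by [].
pose b := mxl1 B * beta * mxl1 B.
have b0 : 0 <= b by rewrite !mulr_ge0 ?mxl1_ge0//; lra.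
pose c := 2 * beta * N; have c0 : 0 <= c by rewrite !mulr_ge0//; lra.
pose rho := N * ((beta + b * T) * expR (c * T)).
have rho0 : 0 <= rho.
  apply: mulr_ge0 => //; apply: mulr_ge0 (expR_ge0 _).
  by apply: addr_ge0; [lra|exact: mulr_ge0].
exists (rho + 1) => [|S Pi Sadm Sb sol t tT]; first by lra.
have Pis := riccati_symmetric T0 Sadm sol.
have Pip s : 0 <= s <= T -> psd (Pi s).
  by move=> sT; apply: form_lower_psd (Pis s sT) (ltW a0) (low S Pi Sadm Sb sol s sT).
have [Pi0 cPi dPi] := (riccati_solutionE T B C S Pi).1 sol.
apply: le_trans (mxl1_psd_le (Pip t tT)) _; apply: (@le_trans _ _ rho); last by lra.
rewrite ler_wpM2l//.
have H : \tr (Pi t) <= (\tr (Pi 0) + b * t) * expR (c * t).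
  apply: (gronwall (f := fun t => \tr (Pi t)) b0 c0 (trace_continuous cPi)) tT.
  move=> s sT; exists (\tr (riccati_rhs B C S (Pi s))).
    exact: trace_is_derive (dPi s sT).
  have sI : 0 <= s <= T by case/andP: sT => /ltW -> /ltW ->.
  case: S Sadm Sb {sol low Pi0 dPi} => [[[A G] W] Q] [_ sW sQ] [Ab _ Wb _].
  rewrite /riccati_rhs !linearD/= linearN/=.
  have Xb := mxl1_psd_le (Pip s sI).
  have h1 : \tr (A *m Pi s) <= beta * (N * \tr (Pi s)).
    by apply: le_trans (tr_le_mxl1 _) _; apply: mxl1M_le.
  have h2 : \tr (Pi s *m A^T) <= beta * (N * \tr (Pi s)).
    apply: le_trans (tr_le_mxl1 _) _; rewrite mulrC.
    by apply: mxl1M_le => //; rewrite mxl1T.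
  have h3 : 0 <= \tr (Pi s *m C^T *m invmx Q *m C *m Pi s).
    apply: psd_tr_ge0.
    have := psd_congr (C *m Pi s) (psd_invmx (spd_psd sQ) (spd_unit sQ)).
    by rewrite trmx_mul Pis// !mulmxA.
  have h4 : \tr (B *m W *m B^T) <= b.
    apply: le_trans (tr_le_mxl1 _) _; apply: mxl1M_le; last by rewrite mxl1T.
    exact: mxl1M_le.
  by rewrite /c; lra.
apply: le_trans H _; case/andP: tT => t0 tT.
have tr0 : 0 <= \tr (Pi 0) by apply: psd_tr_ge0; apply: Pip; rewrite lexx.
apply: ler_pM; rewrite ?expR_ge0 ?ler_expR ?ler_wpM2l//.
  by rewrite addr_ge0// mulr_ge0.
apply: lerD; last by rewrite ler_wpM2l.
apply: le_trans (tr_le_mxl1 _) _; rewrite Pi0.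
by case: S Sb {Sadm sol Pi0 dPi} => [[[A G] W] Q] [_ [Gb _] _ _].
Qed.

Lemma riccati_lipschitz beta : 1 <= beta -> exists2 c, 0 < c &
  forall S1 S2 Pi1 Pi2, admissible S1 -> admissible S2 ->
    entries_bounded_by beta S1 -> entries_bounded_by beta S2 ->
    riccati_solution T B C S1 Pi1 -> riccati_solution T B C S2 Pi2 ->
    forall t : R, 0 <= t <= T -> mxl1 (Pi1 t - Pi2 t) <= c * quad_dist S1 S2.
Proof.
move=> b1; have [rho rho0 up] := riccati_upper b1.
have [c c0 lip] := riccati_rhs_lipschitz B C beta rho.
have [K K0 gron] := mx_gronwall n n T0 (ltW c0).
exists (K * (1 + c)) => [|S1 S2 Pi1 Pi2 a1 a2 e1 e2 sol1 sol2 t tT].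
  by rewrite mulr_gt0//; lra.
have [Pi10 cPi1 dPi1] := (riccati_solutionE T B C S1 Pi1).1 sol1.
have [Pi20 cPi2 dPi2] := (riccati_solutionE T B C S2 Pi2).1 sol2.
have d0 := quad_dist_ge0 S1 S2.
have := gron (fun t => Pi1 t - Pi2 t)
  (fun t => riccati_rhs B C S1 (Pi1 t) - riccati_rhs B C S2 (Pi2 t))
  (c * quad_dist S1 S2) (mulr_ge0 (ltW c0) d0) (mx_continuous_onB cPi1 cPi2)
  (fun s sT => mx_is_deriveB (dPi1 s sT) (dPi2 s sT)) _ t tT.
move=> /(_ _)/le_trans; apply.
  move=> s /andP[/ltW s0 /ltW sT]; have sI : 0 <= s <= T by rewrite s0.
  rewrite -mulrDr; apply: lip => //.
    exact: (up _ _ a1 e1 sol1).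
  exact: (up _ _ a2 e2 sol2).
rewrite -mulrA ler_wpM2l ?(ltW K0)// mulrDl mul1r lerD2r Pi10 Pi20.
case: S1 S2 {a1 a2 e1 e2 sol1 sol2 d0 dPi1 dPi2 Pi10 Pi20} =>
  [[[A1 G1] W1] Q1] [[[A2 G2] W2] Q2] /=.
rewrite /quad_dist/=.
have := (mxl1_ge0 (A1 - A2), mxl1_ge0 (W1 - W2), mxl1_ge0 (Q1 - Q2)).
by move=> [[hA hW] hQ]; lra.
Qed.

End RiccatiBounds.
(** * Gronwall's inequality for indefinite integrals *)

Section IntegralGronwall.
Context {R : realType}.
Notation mu := (@lebesgue_measure R).
Implicit Types (T a : R).

Lemma integrable_subitv (f : R -> R) T t : 0 <= t <= T ->
  mu.-integrable `[0, T] (EFin \o f) -> mu.-integrable `[0, t] (EFin \o f).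
Proof.
move=> /andP[t0 tT]; apply: integrableS => //.
by apply: subset_itvl; rewrite bnd_simp.
Qed.

Lemma continuous_integrable (f : R -> R) T :
  {within `[0, T], continuous f} -> mu.-integrable `[0, T] (EFin \o f).
Proof. by move=> cf; apply: continuous_compact_integrable cf; exact: segment_compact. Qed.

Lemma integrable_fsum d (X : measurableType d) (nu : {measure set X -> \bar R})
    n (h : 'I_n -> X -> R) (D : set X) :
  measurable D -> (forall i, nu.-integrable D (EFin \o h i)) ->
  nu.-integrable D (EFin \o fun s => \sum_i h i s) /\
  (\int[nu]_(s in D) (\sum_i h i s))%R = \sum_i (\int[nu]_(s in D) h i s)%R.
Proof.
move=> mD ih.
suff H (r : seq 'I_n) : nu.-integrable D (EFin \o fun s => \sum_(i <- r) h i s) /\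
    (\int[nu]_(s in D) (\sum_(i <- r) h i s))%R = \sum_(i <- r) (\int[nu]_(s in D) h i s)%R.
  exact: H.
elim: r => [|i r [IH1 IH2]].
  have r0 s : \sum_(i <- [::]) h i s = 0 :> R by rewrite big_nil.
  rewrite (funext r0) big_nil; split; first exact: (integrable0 nu D).
  by rewrite /Rintegral integral0.
have rE s : \sum_(j <- i :: r) h j s = h i s + \sum_(j <- r) h j s.
  by rewrite big_cons.
rewrite (funext rE) big_cons; split.
  by have := integrableD mD (ih i) IH1; apply: eq_integrable.
by rewrite RintegralD// IH2.
Qed.

Lemma continuous_indefinite_integral (f : R -> R) (c T : R) : 0 <= T ->
  mu.-integrable `[0, T] (EFin \o f) ->
  {within `[0, T], continuous (fun t => c + (\int[mu]_(s in `[0, t]) f s)%R)}.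
Proof.
move=> T0 fi; apply: within_continuousD; first exact: within_continuous_cst.
exact: parameterized_integral_continuous.
Qed.

(** The bound [mxl1 (x s) <= c0 + a * U s], where [U] is the indefinite
    integral of the continuous function [fun s => mxl1 (x s)], turns the
    integral inequality into a differential one for the right-hand side, which
    is differentiable even though [x] need not be. *)
Lemma integral_gronwall T a k (x F : R -> 'cV[R]_k) (xi : 'cV[R]_k) (g : R -> R) :
  0 <= T -> 0 <= a ->
  (forall i, mu.-integrable `[0, T] (fun s => (F s i 0)%:E)) ->
  (forall i (t : R), 0 <= t <= T ->
     x t i 0 = xi i 0 + (\int[mu]_(s in `[0, t]) F s i 0)%R) ->
  mu.-integrable `[0, T] (EFin \o g) ->
  (forall s : R, 0 <= s <= T -> 0 <= g s) ->
  (forall s : R, 0 <= s <= T -> mxl1 (F s) <= a * mxl1 (x s) + g s) ->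
  forall t : R, 0 <= t <= T ->
    mxl1 (x t) <= (mxl1 xi + (\int[mu]_(s in `[0%R, T]) g s)%R) * expR (a * T).
Proof.
move=> T0 a0 iF xE ig g0 Fle t tT.
have cx : mx_continuous_on T x.
  move=> i j; rewrite ord1.
  apply: (@subspace_eq_continuous _ `[0, T] _
    (fun t => xi i 0 + (\int[mu]_(s in `[0, t]) F s i 0)%R)).
    move=> s; rewrite inE /= in_itv/= => sT; exact/esym/xE.
  exact: continuous_indefinite_integral (iF i).
pose N s := mxl1 (x s).
have cN : {within `[0, T], continuous N} by exact: mxl1_continuous.
have iN := continuous_integrable cN.
pose U s := (\int[mu]_(u in `[0%R, s]) N u)%R.
pose c0 := mxl1 xi + (\int[mu]_(s in `[0%R, T]) g s)%R.
have int0 s : 0 <= s <= T -> N s <= c0 + a * U s.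
  move=> sT.
  have iFs i : mu.-integrable `[0, s] (EFin \o (fun s => F s i 0)).
    exact: integrable_subitv (iF i).
  have iFs' i : mu.-integrable `[0, s] (EFin \o (fun s => `|F s i 0|)).
    exact: integrable_norm (iFs i).
  have [iS SE] := integrable_fsum (nu := mu) (D := `[0, s]) (measurable_itv _) iFs'.
  have igs := integrable_subitv sT ig; have iNs := integrable_subitv sT iN.
  have iaN : mu.-integrable `[0, s] (EFin \o (fun u => a * N u)).
    exact: (integrableZl _ a iNs).
  apply: (@le_trans _ _ (mxl1 xi + \sum_i (\int[mu]_(s in `[0%R, s]) `|F s i 0|)%R)).
    rewrite /N /mxl1 -big_split/=; apply: ler_sum => i _.
    rewrite !big_ord1 xE//; apply: le_trans (ler_normD _ _) _.
    by rewrite lerD2l; apply: le_normr_Rintegral.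
  rewrite -addrA lerD2l -SE.
  apply: (@le_trans _ _ (\int[mu]_(u in `[0%R, s]) (a * N u + g u))%R).
    apply: le_Rintegral => //.
      exact: (integrableD _ iaN igs).
    move=> u /=; rewrite in_itv/= => /andP[u0 us].
    have uT : 0 <= u <= T by rewrite u0 (le_trans us)//; case/andP: sT.
    apply: le_trans (Fle u uT); rewrite /mxl1.
    by apply: ler_sum => i _; rewrite big_ord1.
  rewrite RintegralD// RintegralZl// [leRHS]addrC.
  apply: lerD; first exact: lexx.
  rewrite -subr_ge0 (@Rintegral_itvB _ _ (BLeft 0) (BRight T))// ?bnd_simp//; last 2 first.
  - by case/andP: sT.
  - by case/andP: sT.
  apply: Rintegral_ge0 => u /=; rewrite in_itv/= => /andP[su uT]; apply: g0.
  by rewrite uT andbT; case/andP: sT => s0 _; rewrite (le_trans s0)// ltW.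
have H : c0 + a * U t <= (c0 + a * U 0 + 0 * t) * expR (a * t).
  apply: (gronwall (f := fun s => c0 + a * U s) (lexx 0) a0) tT.
    apply: within_continuousD; first exact: within_continuous_cst.
    apply: within_continuousM; first exact: within_continuous_cst.
    exact: parameterized_integral_continuous.
  move=> s /andP[s0 sT]; exists (a * N s); last first.
    by rewrite addr0 ler_wpM2l// int0// ltW//= ltW.
  have T00 : 0 < T by exact: lt_trans sT.
  have [dU U'] : derivable U s 1 /\ derive1 U s = N s.
    apply: (continuous_FTC1_closed sT) => //.
    by apply: within_continuous_continuous cN _ => //; rewrite in_itv/= s0.
  have hU : is_derive s (1 : R) U (N s).
    by apply: DeriveDef => //; rewrite -derive1E.
  rewrite -[X in is_derive _ _ _ X]add0r.
  by apply: is_deriveD; exact: is_derive_scale.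
apply: le_trans (int0 t tT) _; apply: le_trans H _.
have -> : U 0 = 0 by rewrite /U set_itv1 Rintegral_set1.
rewrite mulr0 mul0r !addr0; apply: ler_wpM2l.
  by rewrite addr_ge0 ?mxl1_ge0// Rintegral_ge0//= => s; rewrite in_itv; exact: g0.
by rewrite ler_expR ler_wpM2l//; case/andP: tT.
Qed.

End IntegralGronwall.

(** * Bounds for the filter equation *)

Section FilterEstimates.
Context {R : realType} {n m r : nat}.
Variables (T : R) (B : 'M[R]_(n, m)) (C : 'M[R]_(r, n)) (x0 : 'cV[R]_n).
Variable y : R -> 'cV[R]_r.
Hypothesis T0 : 0 < T.
Hypothesis yL2 : square_integrable T y.
Notation mu := (@lebesgue_measure R).
Implicit Types (S : quadruple R n m r) (Pi : R -> 'M[R]_n) (beta rho : R).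

Lemma integrable_open_closed (f : R -> R) :
  mu.-integrable `]0, T[ (EFin \o f) -> mu.-integrable `[0, T] (EFin \o f).
Proof.
move=> fi.
have mf : measurable_fun `[0, T] f.
  by apply: measurable_fun_itv_cc; apply/measurable_EFinP; exact: measurable_int fi.
have E : `[0, T] `\` [set 0; T] = `]0, T[%classic :> set R.
  apply/seteqP; split=> s /=; rewrite !in_itv/=.
    move=> [/andP[s0 sT] /not_orP[/eqP s0' /eqP sT']].
    by rewrite !lt_neqAle s0 sT eq_sym s0' sT'.
  by move=> /andP[s0 sT]; split; [rewrite !ltW|case=> sE; move: s0 sT; rewrite sE ltxx].
apply/(@negligible_integrable _ _ R mu `[0, T] [set 0; T] (EFin \o f)) => //.
- by apply: measurableU; exact: measurable_set1.
- exact/measurable_EFinP.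
- by apply: countable_lebesgue_measure0; exact: finite_set_countable.
- by rewrite E.
Qed.

(** On a bounded interval [1 + y^2] is integrable and dominates [|y|]. *)
Lemma square_integrable_mxl1 :
  mu.-integrable `[0, T] (EFin \o (fun s => mxl1 (y s))).
Proof.
have i1 i : mu.-integrable `[0, T] (EFin \o (fun s => y s i 0)).
  apply: integrable_open_closed; have [my iy] := yL2 i.
  have i2 : mu.-integrable `]0, T[ (EFin \o (fun s => 1 + y s i 0 ^+ 2)).
    have c1 : mu.-integrable `]0, T[ (EFin \o (fun _ => 1 : R)).
      apply: (@integrableS _ _ R mu `[0, T]) => //; first exact: subset_itv_oo_cc.
      by apply: continuous_integrable; exact: within_continuous_cst.
    exact: (integrableD _ c1 iy).
  apply: le_integrable i2 => //; first exact/measurable_EFinP.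
  move=> s _; rewrite lee_fin; apply: le_trans (ler_norm _).
  rewrite -(real_normK (num_real (y s i 0))).
  by have := sqr_ge0 (`|y s i 0| - 1); nra.
have [H _] := integrable_fsum (nu := mu) (D := `[0, T]) (measurable_itv _)
  (fun i => integrable_norm (i1 i)).
apply: eq_integrable H => // s _ /=; congr EFin.
by apply: eq_bigr => i _; rewrite big_ord1.
Qed.

Lemma filter_rhs_bound beta rho : exists2 c, 0 < c &
  forall S Pi t (x : 'cV[R]_n), entries_bounded_by beta S -> mxl1 (Pi t) <= rho ->
    mxl1 (filter_rhs C y S Pi t x) <= c * mxl1 x + c * mxl1 (y t).
Proof.
pose g := mxl1 C; pose l := rho * g * beta.
exists (`|beta| + `|l * g| + `|l| + 1).
  by rewrite ltr_wpDl// !addr_ge0.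
case=> [[[A G] W] Q] Pi t x [Ab _ _ Qb] Pb /=.
have Lb : mxl1 (Pi t *m C^T *m invmx Q) <= l.
  by apply: mxl1M_le => //; apply: mxl1M_le; rewrite ?mxl1T.
have H : mxl1 (A *m x + Pi t *m C^T *m invmx Q *m (y t - C *m x)) <=
    beta * mxl1 x + l * (mxl1 (y t) + g * mxl1 x).
  apply: mxl1D_le; first exact: mxl1M_le.
  by apply: mxl1M_le => //; apply: mxl1B_le => //; exact: mxl1M_le.
apply: le_trans H _.
have := (ler_norm beta, ler_norm (l * g), ler_norm l).
have := (normr_ge0 beta, normr_ge0 (l * g), normr_ge0 l).
have := (mxl1_ge0 x, mxl1_ge0 (y t)).
set nx := mxl1 x; set ny := mxl1 (y t).
move=> [X0 Y0] [[b0 lg0] l0] [[b1 lg1] l1].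
have e1 : beta * nx <= `|beta| * nx by rewrite ler_wpM2r.
have e2 : l * g * nx <= `|l * g| * nx by rewrite ler_wpM2r.
have e3 : l * ny <= `|l| * ny by rewrite ler_wpM2r.
have := mulr_ge0 l0 X0; have := mulr_ge0 b0 Y0; have := mulr_ge0 lg0 Y0; lra.
Qed.

(** Only the second solution has to be bounded: the difference is split so that
    [x1] enters through [x1 - x2] alone.  The factor [1 + mxl1 (y t)] is not
    bounded in [t], but integrable. *)
Lemma filter_rhs_lipschitz beta rho cP rx : 0 <= cP -> exists2 c, 0 < c &
  forall S1 S2 Pi1 Pi2 t (x1 x2 : 'cV[R]_n), admissible S1 -> admissible S2 ->
    entries_bounded_by beta S1 -> entries_bounded_by beta S2 ->
    mxl1 (Pi1 t) <= rho -> mxl1 (Pi2 t) <= rho ->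
    mxl1 (Pi1 t - Pi2 t) <= cP * quad_dist S1 S2 -> mxl1 x2 <= rx ->
    mxl1 (filter_rhs C y S1 Pi1 t x1 - filter_rhs C y S2 Pi2 t x2) <=
    c * mxl1 (x1 - x2) + c * quad_dist S1 S2 * (1 + mxl1 (y t)).
Proof.
move=> cP0; pose g := mxl1 C; pose l := rho * g * beta.
pose dl := rho * g * (beta * 1 * beta) + (rho * 0 + cP * g) * beta.
exists (`|beta| + `|l * g| + `|rx| + `|dl| + `|dl| * (g * `|rx|) + 1).
  by rewrite ltr_wpDl// !addr_ge0// !mulr_ge0// mxl1_ge0.
case=> [[[A1 G1] W1] Q1] [[[A2 G2] W2] Q2] Pi1 Pi2 t x1 x2.
move=> [_ _ sQ1] [_ _ sQ2] [A1b _ _ Q1b] [A2b _ _ Q2b] P1b P2b dP x2b.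
pose eta : R := @quad_dist R n m r (A1, G1, W1, Q1) (A2, G2, W2, Q2).
rewrite -/eta in dP *.
have eta0 : 0 <= eta by exact: quad_dist_ge0.
have [dA dQ] : mxl1 (A1 - A2) <= eta /\ mxl1 (Q1 - Q2) <= 1 * eta.
  have := (mxl1_ge0 (A1 - A2), mxl1_ge0 (G1 - G2), mxl1_ge0 (W1 - W2), mxl1_ge0 (Q1 - Q2)).
  by move=> [[[a g'] w] q]; rewrite /eta /quad_dist/= mul1r; split; lra.
have pP : close_pair rho cP eta (Pi1 t) (Pi2 t) by [].
have pC := close_pair_refl eta (lexx (mxl1 C)).
have pQ := close_pairV (spd_unit sQ1) (spd_unit sQ2) Q1b Q2b dQ.
have [L1b _ dL] := close_pairM (close_pairM pP (close_pairT pC)) pQ.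
rewrite -/g -/l -/dl in L1b dL.
rewrite /filter_rhs.
set L1 := _ *m invmx Q1 in L1b dL *; set L2 := _ *m invmx Q2 in dL *.
have -> : A1 *m x1 + L1 *m (y t - C *m x1) - (A2 *m x2 + L2 *m (y t - C *m x2)) =
    (A1 *m (x1 - x2) + (A1 - A2) *m x2) -
    (L1 *m (C *m (x1 - x2)) - (L1 - L2) *m (y t - C *m x2)).
  rewrite !(mulmxBr, mulmxBl) !mulmxA.
  set a := A1 *m x1; set b := A2 *m x2; set c := A1 *m x2.
  set d := L1 *m y t; set e := L2 *m y t; set f := L1 *m C *m x1.
  set p := L1 *m C *m x2; set q := L2 *m C *m x2.
  by apply/matrixP => i j; rewrite !mxE; ring.
have H : mxl1 ((A1 *m (x1 - x2) + (A1 - A2) *m x2) -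
    (L1 *m (C *m (x1 - x2)) - (L1 - L2) *m (y t - C *m x2))) <=
    (beta * mxl1 (x1 - x2) + eta * rx) +
    (l * (g * mxl1 (x1 - x2)) + dl * eta * (mxl1 (y t) + g * rx)).
  apply: mxl1B_le; first by apply: mxl1D_le; apply: mxl1M_le.
  apply: mxl1B_le; first by apply: mxl1M_le => //; exact: mxl1M_le.
  by apply: mxl1M_le => //; apply: mxl1B_le => //; exact: mxl1M_le.
apply: le_trans H _.
have g0 : 0 <= g by exact: mxl1_ge0.
have := (mxl1_ge0 (x1 - x2), mxl1_ge0 (y t)).
set nx := mxl1 (x1 - x2); set ny := mxl1 (y t) => -[X0 Y0].
set c := _ + 1.
have h1 : (beta + l * g) * nx <= c * nx.
  rewrite ler_wpM2r// /c.
  have := (ler_norm beta, ler_norm (l * g)); have := normr_ge0 rx; have := normr_ge0 dl.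
  have : 0 <= `|dl| * (g * `|rx|) by rewrite !mulr_ge0.
  by move=> ? ? ? [? ?]; lra.
have h2 : rx + dl * (ny + g * rx) <= c * (1 + ny).
  have e1 : dl * ny <= `|dl| * ny by rewrite ler_wpM2r// ler_norm.
  have e2 : dl * (g * rx) <= `|dl| * (g * `|rx|).
    apply: le_trans (ler_norm _) _.
    by rewrite normrM ler_wpM2l// normrM (ger0_norm g0).
  have e3 := ler_norm rx.
  have e4 : 0 <= `|beta| + `|l * g| + `|rx| + `|dl| * (g * `|rx|) + 1.
    by rewrite !addr_ge0// !mulr_ge0.
  have e5 := mulr_ge0 e4 Y0.
  have := (normr_ge0 beta, normr_ge0 (l * g), normr_ge0 dl) => -[[? ?] ?].
  by rewrite /c; lra.
have h3 : eta * (rx + dl * (ny + g * rx)) <= eta * (c * (1 + ny)).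
  by rewrite ler_wpM2l.
lra.
Qed.

Lemma filter_bounded beta : 1 <= beta -> exists rx,
  forall S Pi (x : R -> 'cV[R]_n), admissible S -> entries_bounded_by beta S ->
    riccati_solution T B C S Pi -> filter_solution T C x0 y S Pi x ->
    forall t : R, 0 <= t <= T -> mxl1 (x t) <= rx.
Proof.
move=> b1; have [rho _ up] := riccati_upper B C (ltW T0) b1.
have [c c0 cF] := filter_rhs_bound beta rho.
have iY := square_integrable_mxl1.
have icY : mu.-integrable `[0, T] (EFin \o (fun s => c * mxl1 (y s))).
  exact: (integrableZl _ c iY).
(* The bound is the one that [integral_gronwall] returns. *)
eexists => S Pi x Sadm Sb sol xsol t tT.
apply: (@integral_gronwall _ T c n x (fun s => filter_rhs C y S Pi s (x s)) x0
  (fun s => c * mxl1 (y s)) (ltW T0) (ltW c0)) => //.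
- by move=> i; case: (xsol i).
- by move=> i s sT; case: (xsol i) => _; apply.
- by move=> s _; rewrite mulr_ge0 ?mxl1_ge0// ltW.
- by move=> s sT; apply: cF => //; exact: (up _ _ Sadm Sb sol).
Qed.

Lemma filter_lipschitz beta : 1 <= beta -> exists2 c, 0 < c &
  forall S1 S2 Pi1 Pi2 (x1 x2 : R -> 'cV[R]_n), admissible S1 -> admissible S2 ->
    entries_bounded_by beta S1 -> entries_bounded_by beta S2 ->
    riccati_solution T B C S1 Pi1 -> riccati_solution T B C S2 Pi2 ->
    filter_solution T C x0 y S1 Pi1 x1 -> filter_solution T C x0 y S2 Pi2 x2 ->
    forall t : R, 0 <= t <= T -> mxl1 (x1 t - x2 t) <= c * quad_dist S1 S2.
Proof.
move=> b1; have [rho _ up] := riccati_upper B C (ltW T0) b1.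
have [cP cP0 lipP] := riccati_lipschitz B C (ltW T0) b1.
have [rx xb] := filter_bounded b1.
have [c c0 cF] := filter_rhs_lipschitz beta rho rx (ltW cP0).
pose h s := 1 + mxl1 (y s).
have h0 s : 0 <= h s by rewrite addr_ge0 ?mxl1_ge0.
have ih : mu.-integrable `[0, T] (EFin \o h).
  have c1 : mu.-integrable `[0, T] (EFin \o (fun _ => 1 : R)).
    by apply: continuous_integrable; exact: within_continuous_cst.
  exact: (integrableD _ c1 square_integrable_mxl1).
pose Ih := (\int[mu]_(s in `[0%R, T]) h s)%R.
have Ih0 : 0 <= Ih by exact: Rintegral_ge0.
exists (c * Ih * expR (c * T) + 1).
  by rewrite ltr_wpDl// !mulr_ge0 ?expR_ge0// ltW.
move=> S1 S2 Pi1 Pi2 x1 x2 a1 a2 e1 e2 sol1 sol2 xs1 xs2 t tT.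
have d0 := quad_dist_ge0 S1 S2; set d := quad_dist S1 S2 in d0 *.
have igh : mu.-integrable `[0, T] (EFin \o (fun s => c * d * h s)).
  exact: (integrableZl _ (c * d) ih).
have := @integral_gronwall _ T c n (fun s => x1 s - x2 s)
  (fun s => filter_rhs C y S1 Pi1 s (x1 s) - filter_rhs C y S2 Pi2 s (x2 s)) 0
  (fun s => c * d * h s) (ltW T0) (ltW c0) _ _ igh _ _ t tT.
rewrite mxl10 add0r RintegralZl// -/Ih => H.
apply: (@le_trans _ _ (c * d * Ih * expR (c * T))).
  apply: H.
  - move=> i; have [i1 _] := xs1 i; have [i2 _] := xs2 i.
    apply: eq_integrable (integrableB _ i1 i2) => //.
    by move=> s _ /=; rewrite !mxE.
  - move=> i s sT; have [i1 E1] := xs1 i; have [i2 E2] := xs2 i.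
    rewrite !mxE E1// E2// add0r opprD addrACA subrr add0r.
    rewrite -RintegralB//; first last.
    + exact: integrable_subitv i2.
    + exact: integrable_subitv i1.
    by apply: eq_Rintegral => u _; rewrite !mxE.
  - by move=> s _; rewrite !mulr_ge0// ltW.
  - move=> s sT; apply: cF => //.
    + exact: (up _ _ a1 e1 sol1).
    + exact: (up _ _ a2 e2 sol2).
    + exact: (lipP _ _ _ _ a1 a2 e1 e2 sol1 sol2).
    + exact: (xb _ _ _ a2 e2 sol2 xs2).
have -> : c * d * Ih * expR (c * T) = c * Ih * expR (c * T) * d by ring.
by rewrite ler_wpM2r// lerDl.
Qed.

End FilterEstimates.

(** * The energy minimizer *)

Section EnergyMinimizer.
Context {R : realType} {n : nat} {K : choiceType}.
Variables (Sigma : {fset K}) (P : K -> 'M[R]_n) (x : K -> 'cV[R]_n) (I : K -> R).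
Hypothesis Sigma0 : Sigma != fset0.
Hypothesis Ppsd : forall s, s \in Sigma -> psd (P s).

Lemma fset_card_gt0 : 0 < #|` Sigma|%:R :> R.
Proof. by rewrite ltr0n cardfs_gt0. Qed.

(** The integral terms of the energy, here [I], do not depend on the point, so
    the increment in the direction [v] is the polynomial [2 t L + t^2 q]; its
    nonnegativity for all [t] forces [L = 0] by the discriminant. *)
Lemma minimizer_stationary (xE v : 'cV[R]_n) :
  minimizer (fun xi => (2 * #|` Sigma|%:R)^-1 *
    \sum_(s <- Sigma) (wsq (P s) (xi - x s) + I s)) xE ->
  \sum_(s <- Sigma) dot v (P s *m (xE - x s)) = 0.
Proof.
move=> xEmin; set L := \sum_(s <- _) _.
pose q := \sum_(s <- Sigma) dot v (P s *m v).
have q0 : 0 <= q by rewrite /q big_seq sumr_ge0// => s /Ppsd[_]; apply.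
suff : L ^+ 2 <= 0 * q.
  by rewrite mul0r => L2; apply/eqP; rewrite -sqrf_eq0 eq_le L2 sqr_ge0.
apply: discriminant_le => // t.
have := xEmin (xE + t *: v); rewrite ler_pM2l; last first.
  by rewrite invr_gt0 mulr_gt0// fset_card_gt0.
rewrite -subr_ge0 -sumrB => H; apply: le_trans H _.
rewrite add0r /L /q !mulr_sumr -big_split/= big_seq [leRHS]big_seq; apply: ler_sum => s sS.
have [Ps _] := Ppsd sS.
rewrite [xE + _ - _]addrAC !wsq_dot; move: (xE - x s) => w.
rewrite mulmxDr !dotDr !dotDl -!scalemxAr !dotZr !dotZl.
have -> : dot w (P s *m v) = dot v (P s *m w) by rewrite dotC [RHS]dot_mulmx Ps.
by rewrite le_eqVlt; apply/orP; left; apply/eqP; ring.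
Qed.

(** Stationarity in the direction [d = xE - xb] itself gives
    [sum <d, P d> = sum <d, P (x - xb)>]; coercivity bounds the left-hand side
    below by [|d|^2], and one factor [|d|] cancels. *)
Lemma minimizer_near (k0 k1 : R) (xE xb : 'cV[R]_n) :
  0 <= k0 -> 0 <= k1 ->
  (forall s (z : 'cV[R]_n), s \in Sigma -> dot z z <= k0 * dot z (P s *m z)) ->
  (forall s (z : 'cV[R]_n), s \in Sigma -> mxl1 (P s *m z) <= k1 * mxl1 z) ->
  minimizer (fun xi => (2 * #|` Sigma|%:R)^-1 *
    \sum_(s <- Sigma) (wsq (P s) (xi - x s) + I s)) xE ->
  mxl1 (xE - xb) <=
    n%:R * k0 * k1 * expectation_over Sigma (fun s => mxl1 (x s - xb)).
Proof.
move=> k00 k10 low up xEmin; set d := xE - xb.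
have H : \sum_(s <- Sigma) dot d (P s *m d) =
    \sum_(s <- Sigma) dot d (P s *m (x s - xb)).
  apply/eqP; rewrite -subr_eq0 -sumrB -[X in _ == X](minimizer_stationary d xEmin).
  apply/eqP; apply: eq_bigr => s _; rewrite -dotBr -mulmxBr.
  by congr (dot d (P s *m _)); rewrite /d opprB addrA subrK.
have lb : #|` Sigma|%:R * mxl1 d ^+ 2 <= n%:R * k0 * \sum_(s <- Sigma) dot d (P s *m d).
  have -> : #|` Sigma|%:R * mxl1 d ^+ 2 = \sum_(s <- Sigma) mxl1 d ^+ 2.
    by rewrite big_const_seq count_predT iter_addr_0 mulr_natl.
  rewrite mulr_sumr big_seq [leRHS]big_seq; apply: ler_sum => s sS.
  by apply: le_trans (mxl1_sqr_le d) _; rewrite -mulrA ler_wpM2l// low.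
have ub : \sum_(s <- Sigma) dot d (P s *m (x s - xb)) <=
    mxl1 d * (k1 * \sum_(s <- Sigma) mxl1 (x s - xb)).
  rewrite !mulr_sumr big_seq [leRHS]big_seq; apply: ler_sum => s sS.
  apply: le_trans (ler_norm _) _; apply: le_trans (dot_le _ _) _.
  by rewrite ler_wpM2l ?mxl1_ge0// up.
have [d0|d0] := leP (mxl1 d) 0.
  apply: le_trans d0 _; rewrite !mulr_ge0// ?invr_ge0 ?ler0n//.
  by apply: sumr_ge0 => s _; exact: mxl1_ge0.
rewrite /expectation_over mulrCA [leRHS]mulrC ler_pdivlMr ?fset_card_gt0//.
rewrite -(ler_pM2r d0).
have -> : mxl1 d * #|` Sigma|%:R * mxl1 d = #|` Sigma|%:R * mxl1 d ^+ 2 by ring.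
apply: le_trans lb _; rewrite H.
have := ler_wpM2l (mulr_ge0 (ler0n R n) k00) ub; move/le_trans; apply.
by rewrite le_eqVlt; apply/orP; left; apply/eqP; ring.
Qed.

End EnergyMinimizer.

Section NormComparison.
Context {R : realType} {n m r : nat}.

Lemma mxl1_le_opnorm_nat k (X : 'M[R]_k) (N : nat) :
  (k * k <= N)%N -> mxl1 X <= N%:R * opnorm X.
Proof.
move=> kN; apply: le_trans (mxl1_le_opnorm X) _.
by rewrite ler_wpM2r ?opnorm_ge0// ler_nat.
Qed.

Lemma bounded_by_entries (M : R) : exists2 beta, 1 <= beta &
  forall S : quadruple R n m r, bounded_by M S -> entries_bounded_by beta S.
Proof.
pose N := (n * n + m * m + r * r)%N.
exists (1 + N%:R * `|M|) => [|[[[A G] W] Q]]; first by rewrite lerDl mulr_ge0.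
have H k (X : 'M[R]_k) : (k * k <= N)%N -> opnorm X <= M -> mxl1 X <= 1 + N%:R * `|M|.
  move=> kN XM; apply: le_trans (mxl1_le_opnorm_nat _ kN) _.
  have := ler_wpM2l (ler0n R N) (le_trans XM (ler_norm M)); lra.
have [nN mN rN] : [/\ (n * n <= N)%N, (m * m <= N)%N & (r * r <= N)%N].
  by split; rewrite /N; lia.
by move=> [AM [GM GiM] [WM _] [_ QiM]]; split; [|split| |]; apply: H.
Qed.

Lemma quad_dist_norm1 : exists2 c, 0 < c &
  forall S1 S2 : quadruple R n m r, quad_dist S1 S2 <= c * norm1 (S1 - S2).
Proof.
pose N := (n * n + m * m + r * r)%N.
exists (N%:R + 1) => [|S1 S2]; first by rewrite ltr_wpDl.
rewrite /quad_dist /norm1; case: (S1 - S2) => [[[A G] W] Q].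
have H k (X : 'M[R]_k) : (k * k <= N)%N -> mxl1 X <= (N%:R + 1) * opnorm X.
  move=> kN; apply: le_trans (mxl1_le_opnorm_nat _ kN) _.
  by rewrite ler_wpM2r ?opnorm_ge0// lerDl.
by rewrite !mulrDr; apply: lerD; [apply: lerD; [apply: lerD|]|]; apply: H; rewrite /N; lia.
Qed.

End NormComparison.

Theorem proposition4p10 (R : realType) (T : R) (n m r : nat)
    (B : 'M[R]_(n, m)) (C : 'M[R]_(r, n)) (x0 : 'cV[R]_n)
    (y : R -> 'cV[R]_r) (M : R) :
  0 < T -> square_integrable T y ->
  exists2 cE : R, 0 < cE &
    forall (pA pG pR pQ : nat)
      (SA : {fset 'rV[R]_pA}) (SG : {fset 'rV[R]_pG})
      (SR : {fset 'rV[R]_pR}) (SQ : {fset 'rV[R]_pQ})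
      (A : 'rV[R]_pA -> 'M[R]_n) (G : 'rV[R]_pG -> 'M[R]_n)
      (W : 'rV[R]_pR -> 'M[R]_m) (Q : 'rV[R]_pQ -> 'M[R]_r)
      (Pi : param R pA pG pR pQ -> R -> 'M[R]_n)
      (xhat : param R pA pG pR pQ -> R -> 'cV[R]_n)
      (xE : R -> 'cV[R]_n) (sbar : param R pA pG pR pQ),
    let Sigma := param_set SA SG SR SQ in
    let S := quadruple_of A G W Q in
    let P := fun s t => invmx (Pi s t) in
    SA != fset0 -> SG != fset0 -> SR != fset0 -> SQ != fset0 ->
    (forall s, s \in Sigma -> admissible (S s)) ->
    (forall s, s \in Sigma -> bounded_by M (S s)) ->
    (forall s, s \in Sigma -> riccati_solution T B C (S s) (Pi s)) ->
    (forall s, s \in Sigma ->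
       filter_solution T C x0 y (S s) (Pi s) (xhat s)) ->
    (forall t : R, 0 <= t <= T ->
       minimizer
         (expected_energy Sigma C y (fun s => (S s).2) P xhat t) (xE t)) ->
    sbar \in Sigma ->
    forall t : R, 0 <= t <= T ->
      wnorm (P sbar t) (xE t - xhat sbar t) <=
        cE * expectation_over Sigma (fun s => norm1 (S s - S sbar)).
Proof.
move=> T0 yL2.
have [beta b1 betaP] := @bounded_by_entries R n m r M.
have [cN cN0 cNP] := @quad_dist_norm1 R n m r.
have [a a0 low] := riccati_lower B C (ltW T0) b1.
have [rho rho0 up] := riccati_upper B C (ltW T0) b1.
have [cf cf0 lip] := filter_lipschitz B C x0 T0 yL2 b1.
pose k0 := n%:R * rho; pose k1 : R := n%:R / a.
have k00 : 0 <= k0 by rewrite mulr_ge0// ltW.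
have k10 : 0 <= k1 by rewrite divr_ge0// ltW.
pose c1 := (k1 + 1) * (n%:R * k0 * k1) * (cf * cN).
have c10 : 0 <= c1.
  have k2 : 0 <= k1 + 1 by rewrite addr_ge0.
  apply: mulr_ge0; last by apply: mulr_ge0; exact: ltW.
  by apply: mulr_ge0 => //; apply: mulr_ge0 => //; exact: mulr_ge0.
exists (c1 + 1); first by rewrite ltr_wpDl.
move=> pA pG pR pQ SA SG SR SQ A G W Q Pi xhat xE sbar Sigma S P _ _ _ _.
move=> Sadm Sbnd Psol xsol xEmin sbarS t tT.
have Sb s : s \in Sigma -> entries_bounded_by beta (S s).
  by move=> sS; exact: betaP (Sbnd s sS).
have Plow s : s \in Sigma -> forall z, a * dot z z <= dot z (Pi s t *m z).
  by move=> sS; exact: (low _ _ (Sadm s sS) (Sb s sS) (Psol s sS)).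
have Psym s : s \in Sigma -> (Pi s t)^T = Pi s t.
  by move=> sS; exact: (riccati_symmetric (ltW T0) (Sadm s sS) (Psol s sS)).
have Punit s : s \in Sigma -> Pi s t \in unitmx.
  by move=> sS; apply: form_lower_unit (Psym s sS) a0 (Plow s sS).
have Ppsd s : s \in Sigma -> psd (P s t).
  move=> sS; apply: psd_invmx (Punit s sS).
  exact: form_lower_psd (Psym s sS) (ltW a0) (Plow s sS).
have Pup s (z : 'cV[R]_n) : s \in Sigma -> mxl1 (P s t *m z) <= k1 * mxl1 z.
  by move=> sS; exact: (inverse_mulmx_le z a0 (Punit s sS) (Plow s sS)).
have Pge s (z : 'cV[R]_n) : s \in Sigma -> dot z z <= k0 * dot z (P s t *m z).
  move=> sS.
  have PU : P s t \in unitmx by rewrite unitmx_inv Punit.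
  apply: le_trans (psd_unit_lower z (Ppsd s sS) PU) _.
  rewrite invmxK ler_wpM2r//; first by have [_] := Ppsd s sS; exact.
  by rewrite ler_wpM2l// (up _ _ (Sadm s sS) (Sb s sS) (Psol s sS)).
have Sigma0 : Sigma != fset0 by apply/fset0Pn; exists sbar.
have := minimizer_near Sigma0 Ppsd (xhat sbar t) k00 k10 Pge Pup (xEmin t tT).
set d := xE t - xhat sbar t; set e := expectation_over _ _ => de.
set E := expectation_over _ _.
have card0 := fset_card_gt0 (R := R) Sigma0.
have eE : e <= cf * cN * E.
  rewrite /e /E /expectation_over mulrCA ler_wpM2l ?invr_ge0 ?(ltW card0)//.
  rewrite mulr_sumr big_seq [leRHS]big_seq; apply: ler_sum => s sS.
  have := lip _ _ _ _ _ _ (Sadm s sS) (Sadm _ sbarS) (Sb s sS) (Sb _ sbarS)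
    (Psol s sS) (Psol _ sbarS) (xsol s sS) (xsol _ sbarS) t tT.
  move/le_trans; apply; rewrite -mulrA ler_wpM2l ?(ltW cf0)//; exact: cNP.
have E0 : 0 <= E.
  rewrite /E /expectation_over mulr_ge0 ?invr_ge0 ?(ltW card0)// sumr_ge0// => s _.
  by rewrite /norm1; case: (_ - _) => [[[? ?] ?] ?]; rewrite !addr_ge0 ?opnorm_ge0.
have wd : wnorm (P sbar t) d <= (k1 + 1) * mxl1 d.
  have k2 : 0 <= (k1 + 1) * mxl1 d by rewrite mulr_ge0 ?mxl1_ge0// addr_ge0.
  rewrite /wnorm -[leRHS](ger0_norm k2) -sqrtr_sqr ler_wsqrtr// wsq_dot.
  apply: le_trans (ler_norm _) _; apply: le_trans (dot_le _ _) _.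
  apply: (@le_trans _ _ (mxl1 d * (k1 * mxl1 d))).
    by rewrite ler_wpM2l ?mxl1_ge0// Pup.
  have := sqr_ge0 (mxl1 d); rewrite exprMn expr2; set x := mxl1 d * mxl1 d => x2.
  have -> : mxl1 d * (k1 * mxl1 d) = k1 * x by rewrite /x; ring.
  by rewrite ler_wpM2r//; nra.
apply: le_trans wd _; apply: (@le_trans _ _ (c1 * E)); last first.
  by rewrite ler_wpM2r// lerDl.
have -> : c1 * E = (k1 + 1) * (n%:R * k0 * k1 * (cf * cN * E)) by rewrite /c1; ring.
rewrite ler_wpM2l ?addr_ge0//; apply: le_trans de _; apply: ler_wpM2l eE.
by apply: mulr_ge0 => //; exact: mulr_ge0.
Qed.
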